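(* For every real $\epsilon>0$ there exists a real $\gamma>0$ such that the following holds. Let $D>0$ be a real number and let $G$ be a finite graph with vertex partition $V(G)=V_1\cup\dots\cup V_m$ whose local degree (with respect to this partition) is at most $\gamma D$. Suppose that $|V_i|\ge (1+\epsilon)D$ and $\bar{d}_G(V_i)\le D$ for each $i\in\{1,\dots,m\}$. Then $G$ has an independent transversal with respect to $V_1,\dots,V_m$.
   Context: Graphs are finite and simple. Given a graph $G$ and a partition $V(G)=V_1\cup\dots\cup V_m$ of its vertex set: - An independent transversal of $G$ (with respect to $\{V_i\}$) is an independent set of $G$ containing exactly one vertex from each part $V_i$. - For $i\ne j$, $G[V_i,V_j]$ denotes the bipartite subgraph of $G$ with vertex set $V_i\cup V_j$ consisting of all edges of $G$ with one endpoint in $V_i$ and the other in $V_j$. The local degree of $G$ (with respect to $\{V_i\}$) is the maximum, over all distinct $i,j$, of the maximum degree $\Delta(G[V_i,V_j])$. - For nonempty $U\subseteq V(G)$, the average degree of $U$ in $G$ is $\bar{d}_G(U):=\frac{1}{|U|}\sum_{u\in U}d_G(u)$, where $d_G(u)$ is the degree of $u$ in $G$. *)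

(* Defs.v *)
From HB Require Import structures.
From mathcomp Require Import all_boot all_order all_algebra.
From mathcomp Require Import reals.

Set Implicit Arguments.
Unset Strict Implicit.
Unset Printing Implicit Defensive.

Import Order.TTheory GRing.Theory Num.Theory.

(* A finite simple graph on T is a symmetric irreflexive relation e : rel T. *)

Definition degree (T : finType) (e : rel T) (x : T) : nat :=
  #|[set y | e x y]|.

(* Maximum degree of the graph with vertex set W and edge relation e, where
   the edges of e are meant to have both endpoints in W. *)
Definition max_degree (T : finType) (W : {set T}) (e : rel T) : nat :=
  \max_(x in W) degree e x.

Definition bip_edges (T : finType) (e : rel T) (A B : {set T}) : rel T :=
  [rel x y | e x y &&
     ((x \in A) && (y \in B) || (x \in B) && (y \in A))].

Definition local_degree (T : finType) (e : rel T) (m : nat)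
    (V : 'I_m -> {set T}) : nat :=
  \max_(i < m) \max_(j < m | j != i)
    max_degree (V i :|: V j) (bip_edges e (V i) (V j)).

(* Injectivity is needed because the set of parts forgets repetitions. *)
Definition vertex_partition (T : finType) (m : nat) (V : 'I_m -> {set T}) :
    Prop :=
  injective V /\ partition [set V i | i : 'I_m] [set: T].

Definition avg_degree (R : realType) (T : finType) (e : rel T)
    (U : {set T}) : R :=
  ((\sum_(u in U) (degree e u)%:R) / #|U|%:R)%R.

Definition independent (T : finType) (e : rel T) (S : {set T}) : Prop :=
  {in S &, forall x y, ~~ e x y}.

Definition independent_transversal (T : finType) (e : rel T) (m : nat)
    (V : 'I_m -> {set T}) (S : {set T}) : Prop :=
  independent e S /\ forall i, #|S :&: V i| = 1.

(* Main.v *)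
Require Import Defs.
From HB Require Import structures.
From mathcomp Require Import all_boot all_order all_algebra.
From mathcomp Require Import reals sequences exp.
From mathcomp Require Import ring lra.

Set Implicit Arguments.
Unset Strict Implicit.
Unset Printing Implicit Defensive.

Import Order.TTheory GRing.Theory Num.Theory.
Local Open Scope ring_scope.

(** If every vertex u of V_j were chosen with probability 1/|V_j|, the union
    bound would make at most sum_(u in V_i) d(u) / ((1 + eps) D), that is at
    most a fraction 1/(1 + eps), of V_i adjacent to a chosen vertex, and some
    vertex of V_i would remain available.  This computation uses only the
    average degree, and it suggests treating the parts in small batches, each
    part of the current batch choosing uniformly among its available
    vertices.  The proof makes this work simultaneously for all parts.

    The only probabilistic tool is a local lemma proved by counting
    ([counting_local_lemma]): with N(S) the number of choices violating no
    constraint inside S, one shows N(S) >= beta N(S \ k) by induction on S.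
    Under the conditioned uniform measure, the expectation of a product of
    functions of the coordinates, each at least 1, is then at most what it
    would be for independent coordinates with every excess over 1 divided by
    beta.  Upper tail constraints are therefore controlled by exponential
    moments even when one constraint involves unboundedly many coordinates;
    [pattern_local_lemma] is the resulting criterion.  It is applied three
    times, always with upper tails only.

    Sampling ([sampling]).  Each part is sorted by degree and cut into slots
    of consecutive vertices ([sorted_slots]); one vertex per slot is chosen.
    This replaces D by a bounded quantity n: degrees are scaled down by the
    size of a slot, and two sampled neighbours of a vertex in the same part
    can be forbidden because the local degree is tiny compared with D.  The
    average degree of the sample is under control without any concentration
    argument, since the slots of a class have a common degree bound which is
    at most every degree in the next class.

    Blocks ([block_assignment]).  The parts are coloured with a bounded number
    nb of colours so that every vertex sees at most about 1/nb of its degree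
    in each colour.

    Stages ([stage], [iteration]).  The colour classes are treated in turn.
    If the smallest number of available vertices in a part is about a n, a
    class of vertices of degree chi n loses at most a fraction about
    chi / (nb a) of its vertices in one stage.  The product of the surviving
    fractions is a convex function of chi, so by Jensen's inequality
    ([surv_sum]) the average over the classes is at least its value at the
    average theta of the chi, where the product telescopes to a linear
    function of time, 1 - s theta / nb, which stays positive because
    theta < 1. *)

(** * A local lemma by counting *)

Lemma prodr_ge1 (R : realFieldType) (I : finType) (P : pred I) (F : I -> R) :
  (forall i, P i -> 1 <= F i) -> 1 <= \prod_(i | P i) F i.
Proof.
move=> F1; elim/big_rec: _ => // i x Pi x1; apply: mulr_ege1 => //; exact: F1.
Qed.

Definition mean (R : realFieldType) (T : finType) (A : {set T}) (h : T -> R) : R :=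
  (\sum_(t in A) h t) / #|A|%:R.

Section Mean.
Variables (R : realFieldType) (T : finType) (A : {set T}).
Hypothesis A_neq0 : A != set0.

Let cardA_gt0 : 0 < #|A|%:R :> R.
Proof. by rewrite ltr0n card_gt0. Qed.

Lemma mean_const (c : R) : mean A (fun=> c) = c.
Proof.
by rewrite /mean sumr_const -[c *+ _]mulr_natr mulfK // gt_eqF.
Qed.

Lemma meanB (f g : T -> R) : mean A (fun t => f t - g t) = mean A f - mean A g.
Proof. by rewrite /mean sumrB mulrBl. Qed.

Lemma le_mean (f g : T -> R) :
  (forall t, f t <= g t) -> mean A f <= mean A g.
Proof. by move=> fg; rewrite ler_pM2r ?invr_gt0// ler_sum. Qed.

Lemma mean_ge0 (f : T -> R) : (forall t, 0 <= f t) -> 0 <= mean A f.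
Proof. by move=> f0; rewrite divr_ge0 ?sumr_ge0. Qed.

End Mean.

(** A constraint c asks that the product of the g c j (x j) stay below M c.
    The flag a c j says whether the coordinate j is optional in c, with
    neutral value 1 and g c j >= 1, or compulsory, with g c j >= 0; since the
    latter may vanish, c can only be violated once all its compulsory
    coordinates are present.  This makes violation monotone in the set S of
    coordinates that are taken into account. *)
Section CountingLocalLemma.
Variables (R : realFieldType) (I T C : finType) (A : I -> {set T}).
Hypothesis A_neq0 : forall i, A i != set0.

Local Notation configs := (family A).

Definition upd (x : {ffun I -> T}) (j : I) (t : T) : {ffun I -> T} :=
  [ffun i => if i == j then t else x i].

Lemma upd_same x j t : upd x j t j = t.
Proof. by rewrite ffunE eqxx. Qed.

Lemma upd_other x j t i : i != j -> upd x j t i = x i.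
Proof. by rewrite ffunE => /negbTE ->. Qed.

Lemma upd_updK x j t : upd (upd x j t) j (x j) = x.
Proof. by apply/ffunP=> i; rewrite !ffunE; case: eqP => // ->. Qed.

Lemma upd_configs x j t : x \in configs -> t \in A j -> upd x j t \in configs.
Proof.
move=> /familyP xF tA; apply/familyP => i; rewrite ffunE.
by case: eqP => [->|_]; [exact: tA | exact: xF].
Qed.

(** Independence of one coordinate: exchanging x j with a fresh element of
    A j is an involution of the pairs (x, t). *)
Lemma sum_configs_indep (j : I) (h : T -> R) (Phi : {ffun I -> T} -> R) :
  (forall x t, Phi (upd x j t) = Phi x) ->
  \sum_(x in configs) h (x j) * Phi x
    = mean (A j) h * \sum_(x in configs) Phi x.
Proof.
move=> PhiE.
have cA : #|A j|%:R != 0 :> R by rewrite pnatr_eq0 -lt0n card_gt0.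
apply: (mulfI cA); rewrite mulrA mulrCA divff // mulr1.
rewrite [RHS]mulr_sumr.
under [RHS]eq_bigr do rewrite mulr_suml.
rewrite [LHS]mulr_sumr.
under [LHS]eq_bigr do rewrite mulr_natl -sumr_const.
rewrite !pair_big /=.
pose swap (u : {ffun I -> T} * T) := (upd u.1 j u.2, u.1 j).
rewrite (reindex_onto swap swap) /=; last first.
  by case=> x t _; rewrite /swap /= upd_updK upd_same.
apply: eq_big => [[x t]|[x t] _] /=; last by rewrite upd_same PhiE.
rewrite /swap /= upd_updK upd_same eqxx andbT.
apply/andP/andP => -[xF tA].
  split; last by have := familyP xF j; rewrite upd_same.
  by rewrite -(upd_updK x j t) upd_configs.
by split; [exact: upd_configs | exact: (familyP xF j)].
Qed.

Variables (D : pred C) (a : C -> I -> bool) (g : C -> I -> T -> R) (M : C -> R).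
Variable (beta : R).
Hypothesis beta_gt0 : 0 < beta.
Hypothesis M_gt0 : forall c, D c -> 0 < M c.
Hypothesis g_ge : forall c i t, (a c i)%:R <= g c i t.

Definition violated (c : C) (S : {set I}) (x : {ffun I -> T}) : bool :=
  [forall j, ~~ a c j ==> (j \in S)] && (M c <= \prod_(j in S) g c j (x j)).

Definition good (S : {set I}) (x : {ffun I -> T}) : bool :=
  [forall (c | D c), ~~ violated c S x].

Definition ngood (S : {set I}) : R := \sum_(x in configs) (good S x)%:R.

(** The expectation of g c j after the loss of a factor beta caused by
    conditioning on the other constraints; only the excess over the neutral
    value is affected. *)
Definition inflate (c : C) (j : I) : R :=
  (a c j)%:R + (mean (A j) (g c j) - (a c j)%:R) / beta.

Hypothesis violation_bound : forall k,
  \sum_(c | D c) (M c)^-1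
     * mean (A k) (fun t => if g c k t == (a c k)%:R then 0 else g c k t)
     * \prod_(j | j != k) inflate c j <= 1 - beta.

Lemma violated_mono c (S S' : {set I}) x :
  S' \subset S -> violated c S' x -> violated c S x.
Proof.
move=> sub /andP[/forallP pS' le]; apply/andP; split.
  by apply/forallP => j; apply/implyP => /(implyP (pS' j)); apply/subsetP.
apply: (le_trans le); rewrite (bigID (mem S') (mem S)) /=.
rewrite [X in _ <= X * _](eq_bigl (mem S')); last first.
  by move=> j /=; rewrite andb_idl // => /(subsetP sub).
rewrite ler_peMr ?prodr_ge0 // => [j _|].
  by apply: le_trans (g_ge _ _ _); rewrite ler0n.
apply: prodr_ge1 => j /andP[_ jS'].
apply: le_trans (g_ge c j _).
by have := implyP (pS' j); case: (a c j) => // /(_ isT); rewrite (negbTE jS').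
Qed.

Lemma good_mono (S S' : {set I}) x : S' \subset S -> good S x -> good S' x.
Proof.
move=> sub /forall_inP gS; apply/forall_inP => c Dc.
by apply: contra (gS c Dc); apply: violated_mono.
Qed.

Lemma prod_upd (S : {set I}) (f : I -> T -> R) x j t : j \notin S ->
  \prod_(i in S) f i (upd x j t i) = \prod_(i in S) f i (x i).
Proof.
move=> jS; apply: eq_bigr => i iS; rewrite upd_other //.
by apply: contraNneq jS => <-.
Qed.

Lemma good_upd (S : {set I}) x j t : j \notin S -> good S (upd x j t) = good S x.
Proof.
move=> jS; apply: eq_forallb => c; congr (_ ==> ~~ (_ && (_ <= _))).
by rewrite prod_upd.
Qed.

Lemma ngood_ge0 S : 0 <= ngood S.
Proof. by apply: sumr_ge0 => x _; rewrite ler0n. Qed.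

Lemma mean_g_ge c j : (a c j)%:R <= mean (A j) (g c j).
Proof.
rewrite -[X in X <= _](mean_const (A_neq0 j)); apply: le_mean => //.
Qed.

Lemma inflate_ge c j : (a c j)%:R <= inflate c j.
Proof. by rewrite lerDl divr_ge0 ?subr_ge0 ?mean_g_ge // ltW. Qed.

Lemma inflate_ge0 c j : 0 <= inflate c j.
Proof. by apply: le_trans (inflate_ge c j); rewrite ler0n. Qed.

(** Expanding each factor as its neutral value plus an excess, every excess at
    k frees the coordinate k at the price of replacing ngood S by ngood (S :\ k),
    hence by ngood S / beta. *)
Lemma sum_good_prod (c : C) (S J : {set I}) :
  (forall S' : {set I}, S' \subset S ->
     forall k, k \in S' -> beta * ngood (S' :\ k) <= ngood S') ->
  J \subset S ->
  \sum_(x in configs) (good S x)%:R * \prod_(j in J) g c j (x j)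
    <= ngood S * \prod_(j in J) inflate c j.
Proof.
have [n] := ubnP #|J|; elim: n S J => // n IHn S J cJ ratio sJS.
have [->|[k kJ]] := set_0Vmem J.
  rewrite !big_set0 mulr1 /ngood le_eqVlt; apply/orP; left; apply/eqP.
  by apply: eq_bigr => x _; rewrite big_set0 mulr1.
have kS : k \in S by apply: (subsetP sJS).
pose P x := \prod_(j in J :\ k) g c j (x j).
have P_ge0 x : 0 <= P x.
  by apply: prodr_ge0 => j _; apply: le_trans (g_ge _ _ _); rewrite ler0n.
pose h t := g c k t - (a c k)%:R.
have h_ge0 t : 0 <= h t by rewrite subr_ge0.
have cJ' : (#|J :\ k| < n)%N by move: cJ; rewrite (cardsD1 k) kJ.
have IH1 := IHn S (J :\ k) cJ' ratio (subset_trans (subsetDl _ _) sJS).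
have IH2 : \sum_(x in configs) (good (S :\ k) x)%:R * P x
    <= ngood (S :\ k) * \prod_(j in J :\ k) inflate c j.
  apply: IHn => //; last exact: setSD.
  by move=> S' sS' i iS'; apply: ratio => //; apply: subset_trans sS' (subsetDl _ _).
have -> : \sum_(x in configs) (good S x)%:R * \prod_(j in J) g c j (x j)
   = (a c k)%:R * (\sum_(x in configs) (good S x)%:R * P x)
     + \sum_(x in configs) h (x k) * ((good S x)%:R * P x).
  rewrite mulr_sumr -big_split /=; apply: eq_bigr => x _.
  by rewrite (big_setD1 k kJ) /= -/(P x) -mulrDl addrC subrK mulrCA.
apply: (@le_trans _ _ ((a c k)%:R * (\sum_(x in configs) (good S x)%:R * P x)
     + \sum_(x in configs) h (x k) * ((good (S :\ k) x)%:R * P x))).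
  rewrite lerD2l; apply: ler_sum => x _; apply: ler_wpM2l => //.
  apply: ler_wpM2r => //; rewrite ler_nat.
  case: (boolP (good S x)) => // /(good_mono (subsetDl S [set k])).
  by rewrite /= => ->.
rewrite (sum_configs_indep (j := k) h (Phi := fun x => (good (S :\ k) x)%:R * P x)); last first.
  by move=> x t; rewrite /P good_upd ?prod_upd // !inE eqxx.
rewrite (big_setD1 k kJ) /= [in leRHS]/inflate.
set Q := \prod_(i in J :\ k) inflate c i in IH1 IH2 *.
have Q_ge0 : 0 <= Q by apply: prodr_ge0 => i _; exact: inflate_ge0.
have mE : mean (A k) h = mean (A k) (g c k) - (a c k)%:R.
  by rewrite meanB mean_const.
rewrite -mE mulrDl mulrDr; apply: lerD.
  by rewrite mulrCA ler_wpM2l ?ler0n.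
have m_ge0 : 0 <= mean (A k) h by apply: mean_ge0.
apply: (le_trans (ler_wpM2l m_ge0 IH2)).
rewrite [leRHS](_ : _ = mean (A k) h * ((ngood S / beta) * Q)); last first.
  by ring.
rewrite ler_wpM2l // ler_wpM2r // ler_pdivlMr // mulrC.
exact: ratio.
Qed.

(** The heart of the counting argument.  A choice that is good on S :\ k but
    not on S violates a constraint in which the value at k matters; by Markov's
    inequality the number of these choices is bounded by a weighted sum that
    [sum_good_prod] controls, the smaller sets being covered by induction. *)
Lemma ngood_ratio (S : {set I}) k : k \in S -> beta * ngood (S :\ k) <= ngood S.
Proof.
have [n] := ubnP #|S|; elim: n S k => // n IHn S k cS kS.
set S' := S :\ k.
have cS' : (#|S'| < n)%N by move: cS; rewrite (cardsD1 k) kS.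
have ratio (S'' : {set I}) : S'' \subset S' ->
     forall i, i \in S'' -> beta * ngood (S'' :\ i) <= ngood S''.
  by move=> sub i iS; apply: IHn iS; apply: leq_ltn_trans (subset_leq_card sub) cS'.
have kS' : k \notin S' by rewrite !inE eqxx.
pose f c t := if g c k t == (a c k)%:R then 0 else g c k t.
have f_ge0 c t : 0 <= f c t.
  by rewrite /f; case: ifP => // _; apply: le_trans (g_ge _ _ _); rewrite ler0n.
have g_ge0 c j t : 0 <= g c j t by apply: le_trans (g_ge _ _ _); rewrite ler0n.
pose P c x := \prod_(j in S') g c j (x j).
have P_ge0 c x : 0 <= P c x by apply: prodr_ge0.
pose p c := [forall j, ~~ a c j ==> (j \in S)].
have step x : (good S' x)%:R - (good S x)%:R <=
   \sum_(c | D c) (p c)%:R * ((M c)^-1 * (f c (x k) * ((good S' x)%:R * P c x))).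
  have rhs_ge0 c : D c ->
     0 <= (p c)%:R * ((M c)^-1 * (f c (x k) * ((good S' x)%:R * P c x))).
    move=> Dc; have := M_gt0 Dc => Mc; apply: mulr_ge0; rewrite ?ler0n //.
    by rewrite mulr_ge0 ?invr_ge0 ?(ltW Mc) // mulr_ge0 // mulr_ge0 ?ler0n.
  case gS' : (good S' x); last first.
    apply: (@le_trans _ _ 0); last first.
      by apply: sumr_ge0 => c Dc; move: (rhs_ge0 c Dc); rewrite gS'.
    by rewrite mulr0n sub0r oppr_le0 ler0n.
  case gS : (good S x); first by rewrite subrr sumr_ge0 // => c Dc; move: (rhs_ge0 c Dc); rewrite gS'.
  move/negbT: gS; rewrite negb_forall_in => /exists_inP[c Dc]; rewrite negbK => vS.
  have nvS' : ~~ violated c S' x by move/forall_inP: gS'; apply.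
  rewrite (bigD1 c) //= mulr0n subr0 mulr1n -[leLHS]addr0.
  apply: lerD; last by apply: sumr_ge0 => c' /andP[Dc' _]; move: (rhs_ge0 c' Dc'); rewrite gS'.
  have /andP[pc] := vS; rewrite (big_setD1 k kS) /= -/S' => le.
  rewrite /p pc !mul1r mulrC.
  suff -> : f c (x k) = g c k (x k) by rewrite ler_pdivlMr ?mul1r // M_gt0.
  rewrite /f; case: eqP => // gE; exfalso; move: nvS'; apply/negP; rewrite negbK.
  move: le; rewrite gE; case ack : (a c k) => le; last first.
    by move: le; rewrite mul0r leNgt M_gt0.
  apply/andP; split; last by rewrite mul1r in le.
  apply/forallP => j; apply/implyP => acj; rewrite !inE (implyP (forallP pc j) acj) andbT.
  by apply: contraNneq acj => ->.
have bound : ngood S' - ngood S <= ngood S' * (1 - beta).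
  rewrite /ngood -sumrB; apply: (le_trans (ler_sum _ (fun x _ => step x))).
  rewrite exchange_big /=.
  apply: (@le_trans _ _ (\sum_(c | D c) ngood S' * ((M c)^-1
     * mean (A k) (f c) * \prod_(j | j != k) inflate c j))); last first.
    by rewrite -mulr_sumr ler_wpM2l ?ngood_ge0.
  apply: ler_sum => c Dc.
  have Minv_ge0 : 0 <= (M c)^-1 by rewrite invr_ge0 ltW // M_gt0.
  have m_ge0 : 0 <= mean (A k) (f c) by apply: mean_ge0.
  have Q_ge0 (U : pred I) : 0 <= \prod_(j | U j) inflate c j.
    by apply: prodr_ge0 => j _; apply: inflate_ge0.
  rewrite -!mulr_sumr.
  case pc : (p c); last first.
    by rewrite mul0r mulr_ge0 ?ngood_ge0 // mulr_ge0 ?Q_ge0 // mulr_ge0.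
  rewrite mul1r (sum_configs_indep (j := k) (f c)
      (Phi := fun x => (good S' x)%:R * P c x)); last first.
    by move=> x t; rewrite /P good_upd ?prod_upd.
  rewrite -mulrA [leRHS]mulrCA ler_wpM2l // [leRHS]mulrCA ler_wpM2l //.
  apply: (le_trans (sum_good_prod c ratio (subxx _))).
  rewrite ler_wpM2l ?ngood_ge0 //.
  rewrite [leRHS](bigID (mem S')) /=.
  rewrite [X in _ <= X * _](eq_bigl (mem S')); last first.
    by move=> j /=; rewrite !inE andbA andbb.
  rewrite ler_peMr //.
  apply: prodr_ge1 => j; rewrite !inE => /andP[jk]; rewrite jk /= => jS.
  apply: le_trans (inflate_ge c j).
  by have := implyP (forallP pc j); case: (a c j) => // /(_ isT); rewrite (negbTE jS).
move: bound; rewrite mulrBr mulr1 mulrC; lra.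
Qed.

Lemma counting_local_lemma :
  (forall c, D c -> (forall j, a c j) -> 1 < M c) ->
  exists x : {ffun I -> T}, (forall i, x i \in A i) /\
    forall c, D c -> \prod_j g c j (x j) < M c.
Proof.
move=> M_gt1.
have pos (S : {set I}) : 0 < ngood S.
  have [n] := ubnP #|S|; elim: n S => // n IHn S cS.
  have [->|[k kS]] := set_0Vmem S; last first.
    apply: lt_le_trans (ngood_ratio kS); rewrite mulr_gt0 // IHn //.
    by move: cS; rewrite (cardsD1 k) kS.
  pose x0 : {ffun I -> T} := [ffun i => xchoose (set0Pn _ (A_neq0 i))].
  have x0F : x0 \in configs.
    by apply/familyP => i; rewrite ffunE; apply: xchooseP.
  rewrite /ngood (bigD1 x0) //= ltr_pwDl //; last first.
    by apply: sumr_ge0 => x _; rewrite ler0n.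
  rewrite ltr0n lt0b; apply/forall_inP => c Dc; apply/negP => /andP[/forallP ac].
  rewrite big_set0; apply/negP; rewrite -ltNge M_gt1 // => j.
  by have := ac j; rewrite inE implybF negbK.
have := pos [set: I]; rewrite /ngood => Npos.
have /existsP[x /andP[xF gx]] : [exists x, (x \in configs) && good [set: I] x].
  apply: contraTT Npos; rewrite negb_exists => /forallP none.
  rewrite big1 ?ltxx // => x xF.
  by have := none x; rewrite xF /= => /negbTE ->.
exists x; split; first by move=> i; apply: (familyP xF).
move=> c Dc; have := forall_inP gx c Dc; rewrite negb_and -ltNge => /orP[|].
  by case/forallPn => j; rewrite inE implybT.
rewrite (eq_bigl xpredT) // => j; exact: in_setT.
Qed.

End CountingLocalLemma.

(** * Forbidden patterns and exponential tails *)

(** A constraint consists of a pattern, the prescribed values v c j for j in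
    P c, and of a bound t c on the number of the other coordinates that hit
    B c j; it is violated when the pattern occurs and the bound is reached.
    An empty pattern gives a pure tail bound and t c = 0 forbids the pattern
    outright.  The count enters the local lemma through its exponential moment
    at lam, and mu c bounds its expectation. *)
Section PatternLocalLemma.
Variables (R : realType) (I T C : finType) (A : I -> {set T}).
Hypothesis A_neq0 : forall i, A i != set0.
Variables (D : pred C) (P : C -> {set I}) (v : C -> I -> T).
Variables (B : C -> I -> {set T}) (t mu : C -> R) (beta lam : R).
Hypotheses (beta_gt0 : 0 < beta) (lam_gt0 : 0 < lam).

Definition hit_prob (c : C) (k : I) : R := #|A k :&: B c k|%:R / #|A k|%:R.

Hypothesis t_gt0 : forall c, D c -> P c = set0 -> 0 < t c.
Hypothesis mu_ge : forall c, D c -> \sum_j hit_prob c j <= mu c.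

Definition pattern_weight (c : C) : R := \prod_(j in P c) (beta * #|A j|%:R)^-1.

Hypothesis sum_bound : forall k,
  \sum_(c | D c) pattern_weight c
      * expR ((expR lam - 1) / beta * mu c - lam * t c)
      * ((k \in P c)%:R + expR lam * hit_prob c k) <= 1 - beta.

Let a c j := j \notin P c.
Let g c j (u : T) : R :=
  if j \in P c then (u == v c j)%:R else if u \in B c j then expR lam else 1.

Let elam_gt1 : 1 < expR lam.
Proof. by rewrite expR_gt1. Qed.

Let rate_ge0 : 0 <= (expR lam - 1) / beta.
Proof. by apply: divr_ge0; [rewrite subr_ge0|]; apply: ltW. Qed.

Let cA_gt0 j : 0 < #|A j|%:R :> R.
Proof. by rewrite ltr0n card_gt0. Qed.

Lemma mean_ind_le (k : I) (S : {set T}) (y : R) :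
  mean (A k) (fun u => if u \in S then y else 0) = y * (#|A k :&: S|%:R / #|A k|%:R).
Proof.
rewrite /mean mulrA; congr (_ / _).
rewrite -big_mkcondr /= sumr_const -[y *+ _]mulr_natr; congr (_ * _%:R).
by apply: eq_card => u; rewrite !inE.
Qed.

Lemma hit_prob_ge0 c k : 0 <= hit_prob c k.
Proof. by rewrite divr_ge0 ?ler0n. Qed.

Let mean_pattern c j : j \in P c -> mean (A j) (g c j) <= #|A j|%:R^-1.
Proof.
move=> jP; rewrite (_ : mean _ _ =
    mean (A j) (fun u => if u \in [set v c j] then 1 else 0)); last first.
  congr (_ / _); apply: eq_bigr => u _; rewrite /g jP inE; by case: eqP.
rewrite mean_ind_le mul1r -[leRHS]mul1r ler_pM2r ?invr_gt0 //.
by rewrite -[1]/(1%:R) ler_nat -(cards1 (v c j)) subset_leq_card ?subsetIr.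
Qed.

Let mean_count c j : j \notin P c ->
  mean (A j) (g c j) = 1 + (expR lam - 1) * hit_prob c j.
Proof.
move=> jP; rewrite -mean_ind_le -[X in X + _](mean_const (A_neq0 j)).
rewrite /mean -mulrDl -big_split /=; congr (_ / _); apply: eq_bigr => u _.
by rewrite /g (negbTE jP); case: ifP => _; rewrite ?addr0 // addrC subrK.
Qed.

Let mean_hit c j : j \notin P c ->
  mean (A j) (fun u => if g c j u == 1 then 0 else g c j u) = expR lam * hit_prob c j.
Proof.
move=> jP; rewrite -mean_ind_le; congr (_ / _); apply: eq_bigr => u _.
rewrite /g (negbTE jP); case: (u \in B c j); last by rewrite eqxx.
by rewrite gt_eqF.
Qed.

Lemma pattern_local_lemma :
  exists x : {ffun I -> T}, (forall i, x i \in A i) /\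
    forall c, D c -> (forall j, j \in P c -> x j = v c j) ->
      #|[set j | (j \notin P c) && (x j \in B c j)]|%:R < t c.
Proof.
have M_gt0 c : D c -> 0 < expR (lam * t c) by rewrite expR_gt0.
have g_ge c j u : (a c j)%:R <= g c j u.
  rewrite /a /g; case: (j \in P c) => /=; first by rewrite ler0n.
  by case: ifP => // _; apply: ltW.
have M_gt1 c : D c -> (forall j, a c j) -> 1 < expR (lam * t c).
  move=> Dc ac; rewrite expR_gt1 mulr_gt0 // t_gt0 //.
  by apply/setP => j; rewrite inE; apply/negbTE/ac.
have infl c j : inflate A a g beta c j <= 
    if j \in P c then (beta * #|A j|%:R)^-1
    else expR ((expR lam - 1) / beta * hit_prob c j).
  rewrite /inflate /a; case: ifPn => jP /=.
    by rewrite add0r subr0 invfM mulrC ler_pM2l ?invr_gt0 // mean_pattern.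
  rewrite mean_count // addrAC subrr add0r mulrAC.
  exact: expR_ge1Dx.
have [k|x [xA xM]] := counting_local_lemma A_neq0 beta_gt0 M_gt0 g_ge _ M_gt1.
  apply: le_trans (sum_bound k); apply: ler_sum => c Dc.
  have prodP (J : pred I) : 0 <= \prod_(j | J j) inflate A a g beta c j.
    by apply: prodr_ge0 => j _; apply: inflate_ge0.
  pose e j := expR ((expR lam - 1) / beta * hit_prob c j).
  have e_ge1 j : 1 <= e j.
    by rewrite /e -[X in X <= _]expR0 ler_expR mulr_ge0 ?hit_prob_ge0.
  pose W J := \prod_(j in P c | J j) (beta * #|A j|%:R)^-1.
  have W_ge0 J : 0 <= W J.
    by apply: prodr_ge0 => j _; rewrite invr_ge0 mulr_ge0 ?ltW.
  have pW (J : pred I) : \prod_(j | J j) inflate A a g beta c j <=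
      W J * expR ((expR lam - 1) / beta * mu c).
    rewrite (bigID (mem (P c))) /=; apply: ler_pM => //.
      rewrite /W [leRHS](eq_bigl (fun j => J j && (j \in P c))); last first.
        by move=> j; rewrite andbC.
      apply: ler_prod => j /andP[_ jP]; rewrite inflate_ge0 //=.
      by have := infl c j; rewrite jP.
    apply: (@le_trans _ _ (\prod_j e j)).
      rewrite [leRHS](bigID (fun j => J j && (j \notin P c))) /=.
      rewrite -[leLHS]mulr1; apply: ler_pM => //; last exact: prodr_ge1.
      apply: ler_prod => j /andP[_ jP]; rewrite inflate_ge0 //=.
      by have := infl c j; rewrite (negbTE jP).
    by rewrite -expR_sum ler_expR -mulr_sumr ler_wpM2l ?mu_ge.
  rewrite expRB -mulrA; set E := expR _ in pW *; set M := expR (lam * t c).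
  have E_ge0 : 0 <= E := expR_ge0 _.
  have M_ge0 : 0 <= M^-1 by rewrite invr_ge0 expR_ge0.
  rewrite /a; case kP : (k \in P c) => /=.
    have m_le : mean (A k) (fun u => if g c k u == 0 then 0 else g c k u)
        <= #|A k|%:R^-1.
      apply: le_trans (mean_pattern kP); apply: le_mean => // u.
      by case: eqP => // ->.
    have m_ge0 : 0 <= mean (A k) (fun u => if g c k u == 0 then 0 else g c k u).
      apply: mean_ge0 => // u; case: ifP => // _.
      by apply: le_trans (g_ge c k u); rewrite ler0n.
    have := pW (fun j => j != k) => /(ler_pM m_ge0 (prodP _) m_le).
    move=> /(ler_wpM2l M_ge0); rewrite mulrA => /le_trans; apply.
    have -> : pattern_weight c = (beta * #|A k|%:R)^-1 * W (fun j => j != k).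
      by rewrite /pattern_weight (bigD1 k).
    apply: (@le_trans _ _ ((beta * #|A k|%:R)^-1 * W (fun j => j != k) * (E / M))); last first.
      rewrite ler_peMr //.
        apply: mulr_ge0; last by rewrite mulr_ge0.
        by rewrite mulr_ge0 ?invr_ge0 // mulr_ge0 // ltW.
      by rewrite lerDl mulr_ge0 ?expR_ge0 ?hit_prob_ge0.
    have b1 : 1 <= beta^-1.
      rewrite invf_ge1 //; have := sum_bound k.
      rewrite -[beta <= 1]subr_ge0; apply: le_trans; apply: sumr_ge0 => c' _.
      apply: mulr_ge0; last first.
        by rewrite addr_ge0 ?ler0n // mulr_ge0 ?expR_ge0 ?hit_prob_ge0.
      rewrite mulr_ge0 ?expR_ge0 //.
      by apply: prodr_ge0 => j _; rewrite invr_ge0; apply: mulr_ge0 => //; apply: ltW.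
    rewrite invfM -!mulrA.
    rewrite [leLHS](_ : _ = 1 * (#|A k|%:R^-1 * (W (fun j => j != k) * (E / M)))).
      by rewrite ler_wpM2r // !mulr_ge0 // invr_ge0 ltW.
    by ring.
  rewrite mean_hit ?kP // add0r.
  have := pW (fun j => j != k).
  have -> : W (fun j => j != k) = pattern_weight c.
    by apply: eq_bigl => j; case: eqP => [->|]; rewrite ?kP ?andbT.
  have q_ge0 : 0 <= M^-1 * (expR lam * hit_prob c k).
    by rewrite mulr_ge0 // mulr_ge0 ?expR_ge0 ?hit_prob_ge0.
  move=> /(ler_wpM2l q_ge0) le; rewrite [leLHS]mulrA; apply: (le_trans le).
  by rewrite le_eqVlt; apply/orP; left; apply/eqP; ring.
exists x; split=> // c Dc xv.
have := xM c Dc; set J := [set j | _].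
have -> : \prod_j g c j (x j) = expR (lam * #|J|%:R).
  rewrite mulrC expRM_natl -prodr_const (big_mkcond (mem J)) /=.
  apply: eq_bigr => j _; rewrite /J inE /g.
  by case jP: (j \in P c) => //=; rewrite xv ?eqxx.
by rewrite ltr_expR ltr_pM2l.
Qed.

End PatternLocalLemma.

(** * Splitting the parts into blocks *)

Definition nbrs (T : finType) (e : rel T) (X : {set T}) (u : T) : {set T} :=
  [set w in X | e u w].

Lemma sum_card_nbrs (T : finType) (e : rel T) (U W : {set T}) : symmetric e ->
  (\sum_(u in U) #|nbrs e W u| = \sum_(w in W) #|nbrs e U w|)%N.
Proof.
move=> e_sym.
under eq_bigr do rewrite -sum1dep_card.
under [RHS]eq_bigr do rewrite -sum1dep_card.
rewrite (exchange_big_dep (mem W)) /=; last by move=> u w _ /andP[].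
apply: eq_bigr => w wW; apply: eq_bigl => u; by rewrite wW e_sym.
Qed.

Section Blocks.
Variables (R : realType) (I T : finType) (e : rel T) (p : T -> I) (X : {set T}).
Variables (nb : nat) (psi t : T -> R) (N lam beta Lam : R).
Hypothesis e_sym : symmetric e.
Hypothesis nb_gt0 : (0 < nb)%N.
Hypotheses (lam_gt0 : 0 < lam) (beta_gt0 : 0 < beta).
Hypothesis local1 : {in X, forall u i, (#|[set w in nbrs e X u | p w == i]| <= 1)%N}.
Hypothesis deg_le : {in X, forall u, #|nbrs e X u|%:R <= psi u}.
Hypothesis part_le : forall i, \sum_(w in X | p w == i) #|nbrs e X w|%:R <= N.
Hypothesis t_gt0 : {in X, forall u, 0 < t u}.
Hypothesis tail : {in X, forall u,
  (expR lam - 1) / beta * (psi u / nb%:R) - lam * t u <= - Lam}.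
Hypothesis small : N * expR (lam - Lam) <= 1 - beta.

(** The constraint at (u, s) concerns the parts that contain neighbours of u.
    As each of these contains a single neighbour, counting parts of colour s
    is the same as counting neighbours in them. *)
Lemma block_assignment :
  exists r : I -> 'I_nb, {in X, forall u s,
    #|[set w in nbrs e X u | r (p w) == s]|%:R < t u}.
Proof.
pose seen u := p @: nbrs e X u.
pose B (c : T * 'I_nb) (j : I) := if j \in seen c.1 then [set c.2] else set0.
pose P (c : T * 'I_nb) : {set I} := set0.
pose A (i : I) := [set: 'I_nb].
have A0 i : A i != set0.
  by apply/set0Pn; exists (Ordinal nb_gt0); rewrite inE.
have hp c j : hit_prob R A B c j = (j \in seen c.1)%:R / nb%:R.
  rewrite /hit_prob /A cardsT card_ord setTI /B; case: ifP => _.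
    by rewrite cards1.
  by rewrite cards0.
have nbR : 0 < nb%:R :> R by rewrite ltr0n.
have card_seen u : (#|seen u| <= #|nbrs e X u|)%N by apply: leq_imset_card.
have [c Dc|k|r [_ rP]] := @pattern_local_lemma R I _ _ A A0 (fun c => c.1 \in X) P
    (fun c j => c.2) B (fun c => t c.1) (fun c => psi c.1 / nb%:R) beta lam
    beta_gt0 lam_gt0 (fun c Xc _ => t_gt0 Xc).
- under eq_bigr do rewrite hp.
  rewrite -mulr_suml ler_pM2r ?invr_gt0 //.
  apply: le_trans (deg_le Dc); rewrite -natr_sum ler_nat.
  apply: leq_trans (card_seen _); rewrite -sum1_card [leqRHS]big_mkcond /=.
  by apply: leq_sum => j _; case: (j \in _).
- apply: le_trans small; rewrite [lam - Lam]addrC expRD [N * _]mulrC -mulrA.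
  apply: (@le_trans _ _ (\sum_(c : T * 'I_nb | c.1 \in X)
     expR (- Lam) * (expR lam * ((k \in seen c.1)%:R / nb%:R)))).
    apply: ler_sum => c Dc; rewrite /pattern_weight /P big_set0 mul1r in_set0 add0r hp.
    rewrite ler_wpM2r ?mulr_ge0 ?expR_ge0 ?invr_ge0 ?ler0n //.
    by rewrite ler_expR; apply: tail.
  rewrite -mulr_sumr ler_wpM2l ?expR_ge0 // -mulr_sumr ler_wpM2l ?expR_ge0 //.
  apply: le_trans (part_le k).
  rewrite (eq_bigl (fun c : T * 'I_nb => (c.1 \in X) && xpredT c.2)); last first.
    by move=> c; rewrite andbT.
  rewrite -(pair_big (mem X) xpredT (fun u _ => (k \in seen u)%:R / nb%:R)) /=.
  under eq_bigr do rewrite sumr_const card_ord -[_ *+ nb]mulr_natr divfK ?gt_eqF //.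
  rewrite -!natr_sum ler_nat [leqRHS](eq_bigl (mem [set w in X | p w == k])); last first.
    by move=> w; rewrite !inE.
  rewrite -(sum_card_nbrs X _ e_sym); apply: leq_sum => u uX.
  case: imsetP => // -[w wn kw]; rewrite card_gt0; apply/set0Pn; exists w.
  by move: wn; rewrite !inE => /andP[-> ->]; rewrite kw eqxx.
- exists r => u uX s.
  have pat j : j \in P (u, s) -> r j = s by rewrite inE.
  apply: le_lt_trans (rP (u, s) uX pat).
  rewrite ler_nat -(card_in_imset (f := p)); last first.
    move=> w w'; rewrite !inE => /andP[/andP[wX uw] _] /andP[/andP[w'X uw'] _] pw.
    by have /card_le1_eqP := local1 uX (p w); apply; rewrite !inE ?wX ?w'X ?pw eqxx ?andbT.
  apply: subset_leq_card; apply/subsetP => _ /imsetP[w wN ->].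
  move: wN; rewrite inE => /andP[wN rw]; rewrite !inE /=.
  by rewrite /B /= /seen imset_f // inE.
Qed.
End Blocks.

(** * Sampling a bounded number of vertices per part *)

Section Sampling.
Variables (R : realType) (I K T : finType) (e : rel T) (kap : T -> K) (p : T -> I).
Variables (Y : {set T}) (q Fmax L lam beta Lam : R) (F t : T -> R).

Definition slot (k : K) : {set T} := [set v in Y | kap v == k].

Hypothesis e_sym : symmetric e.
Hypothesis e_slot : forall v w, e v w -> kap v != kap w.
Hypotheses (lam_gt0 : 0 < lam) (beta_gt0 : 0 < beta) (q_gt0 : 0 < q).
Hypothesis L_ge0 : 0 <= L.
Hypothesis slot_ge : forall k, q <= #|slot k|%:R.
Hypothesis deg_le : {in Y, forall v, #|nbrs e Y v|%:R <= F v}.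
Hypothesis F_le : {in Y, forall v, F v <= Fmax}.
Hypothesis loc_le : {in Y, forall v i, #|[set w in nbrs e Y v | p w == i]|%:R <= L}.
Hypothesis tail : {in Y, forall v,
  (expR lam - 1) / beta * (F v / q) - lam * t v <= - Lam}.
Hypothesis small :
  expR (- Lam) / beta + expR (lam - Lam) * (Fmax / (q * beta))
    + 3%:R * (Fmax * L / (q ^+ 2 * beta ^+ 3)) <= 1 - beta.

Let slot_gt0 k : 0 < #|slot k|%:R :> R.
Proof. exact: lt_le_trans (slot_ge k). Qed.

Let slot_neq0 k : slot k != set0.
Proof. by rewrite -card_gt0 -(ltr0n R) slot_gt0. Qed.

Lemma sum_card_slot (U : {set T}) : U \subset Y ->
  (\sum_k #|slot k :&: U| = #|U|)%N.
Proof.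
move=> UY; rewrite -[in RHS]sum1_card (partition_big kap xpredT) //=.
apply: eq_bigr => k _; rewrite sum1dep_card; apply: eq_card => v; rewrite !inE.
by case vU: (v \in U); rewrite ?andbF //= (subsetP UY) ?andbT.
Qed.

Let nbrsY v : nbrs e Y v \subset Y.
Proof. by apply/subsetP => w; rewrite inE => /andP[]. Qed.

Let pair_ok (c : T * T) := (c.1 \in Y) && (c.2 \in nbrs e Y c.1).
Let third (c : T * T) (w : T) :=
  [&& w \in nbrs e Y c.1, p c.2 == p w & kap c.2 != kap w].
Let triple (c : T * T * T) := pair_ok c.1 && third c.1 c.2.
Let weight (c : T * T * T) : R :=
  (beta * #|slot (kap c.1.1)|%:R)^-1 * ((beta * #|slot (kap c.1.2)|%:R)^-1
    * (beta * #|slot (kap c.2)|%:R)^-1).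

Let inv_slot_le k : (beta * #|slot k|%:R)^-1 <= (beta * q)^-1.
Proof. by rewrite lef_pV2 ?posrE ?mulr_gt0 // ler_pM2l. Qed.

Let inv_slot_ge0 k : 0 <= (beta * #|slot k|%:R)^-1.
Proof. by rewrite invr_ge0 mulr_ge0 // ltW. Qed.

(** The triples (v, w, w') are the reasons why a sampled vertex v may have two
    sampled neighbours w and w' in the same part.  Fixing a vertex of the
    triple in a given slot leaves a degree choice and a local degree choice
    for the other two. *)
Let triple_count (Phi : pred (T * T)) k :
  (\sum_(c | pair_ok c && Phi c) 1 <= #|slot k|%:R * Fmax :> R) ->
  \sum_(c | triple c && Phi c.1) 1 <= #|slot k|%:R * (Fmax * L) :> R.
Proof.
move=> le; rewrite mulrA.
rewrite (eq_bigl (fun c : T * T * T => (pair_ok c.1 && Phi c.1) && third c.1 c.2)); last first.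
  by move=> c; rewrite /triple andbAC.
rewrite -(pair_big_dep (fun c => pair_ok c && Phi c) third (fun _ _ => 1)) /=.
apply: le_trans (ler_wpM2r L_ge0 le); rewrite mulr_suml; apply: ler_sum => c.
move=> /andP[/andP[cY _] _]; rewrite mul1r.
apply: le_trans (loc_le cY (p c.2)).
have -> : \sum_(w | third c w) 1 = #|[set w | third c w]|%:R :> R.
  by rewrite -sum1dep_card natr_sum.
rewrite ler_nat subset_leq_card //.
apply/subsetP => w; rewrite inE => /and3P[wn /eqP pw _].
by rewrite inE wn pw eqxx.
Qed.

Let triple_sum (Phi : pred (T * T * T)) k :
  (\sum_(c | triple c && Phi c) 1 <= #|slot k|%:R * (Fmax * L) :> R) ->
  (forall c, triple c -> Phi c ->
     weight c <= (beta * #|slot k|%:R)^-1 * ((beta * q)^-1 * (beta * q)^-1)) ->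
  \sum_(c | triple c && Phi c) weight c <= Fmax * L / (q ^+ 2 * beta ^+ 3).
Proof.
move=> cnt wle.
apply: (@le_trans _ _ (\sum_(c | triple c && Phi c)
    1 * ((beta * #|slot k|%:R)^-1 * ((beta * q)^-1 * (beta * q)^-1)))).
  by apply: ler_sum => c /andP[tc Pc]; rewrite mul1r wle.
rewrite -mulr_suml; apply: le_trans (ler_wpM2r _ cnt) _.
  by rewrite mulr_ge0 // -expr2 sqr_ge0.
rewrite le_eqVlt; apply/orP; left; apply/eqP; field.
by rewrite !gt_eqF.
Qed.

Let first_count k :
  \sum_(c | pair_ok c && (kap c.1 == k)) 1 <= #|slot k|%:R * Fmax :> R.
Proof.
rewrite (eq_bigl (fun c : T * T => (c.1 \in slot k) && (c.2 \in nbrs e Y c.1))); last first.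
  by move=> c; rewrite /pair_ok [_ \in slot _]inE andbAC.
rewrite -(pair_big_dep (mem (slot k)) (fun v w => w \in nbrs e Y v) (fun _ _ => 1)) /=.
under eq_bigr do rewrite sumr_const.
rewrite mulr_natl -sumr_const; apply: ler_sum => v; rewrite inE => /andP[vY _].
exact: le_trans (deg_le vY) (F_le vY).
Qed.

Let second_count k :
  \sum_(c | pair_ok c && (kap c.2 == k)) 1 <= #|slot k|%:R * Fmax :> R.
Proof.
apply: le_trans (first_count k).
rewrite (reindex_inj (h := fun c : T * T => (c.2, c.1))) /=; last first.
  by move=> [u w] [u' w'] /= [-> ->].
rewrite le_eqVlt; apply/orP; left; apply/eqP; apply: eq_bigl => c.
rewrite /pair_ok !inE /= e_sym; congr (_ && _); by case: (c.1 \in Y); case: (c.2 \in Y).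
Qed.

(** The bound on the failure weights is independent of the size of the graph:
    a constraint centred at v is charged to a slot k at most in proportion to
    the number of neighbours of v in k, divided by the size of k. *)
Lemma sampling : exists X : {set T}, [/\ X \subset Y,
  (forall k, #|X :&: slot k| = 1%N),
  {in X, forall v, #|nbrs e X v|%:R < t v} &
  {in X, forall v i, (#|[set w in nbrs e X v | p w == i]| <= 1)%N}].
Proof.
pose D (c : T + T * T * T) := match c with inl v => v \in Y | inr c => triple c end.
pose P (c : T + T * T * T) : {set K} := match c with inl v => [set kap v]
  | inr c => kap c.1.1 |: (kap c.1.2 |: [set kap c.2]) end.
pose val (c : T + T * T * T) k := match c with inl v => v
  | inr c => if k == kap c.1.1 then c.1.1 else if k == kap c.1.2 then c.1.2 else c.2 end.
pose B (c : T + T * T * T) (k : K) :=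
  match c with inl v => nbrs e Y v | inr _ => set0 end.
pose tt (c : T + T * T * T) : R := match c with inl v => t v | inr _ => 0 end.
pose mu (c : T + T * T * T) : R := match c with inl v => F v / q | inr _ => 0 end.
have P0 c : D c -> P c = set0 -> 0 < tt c.
  move=> _ P0; exfalso; have : P c != set0; last by rewrite P0 eqxx.
  by apply/set0Pn; case: c {P0} => [v|c]; [exists (kap v)|exists (kap c.1.1)]; rewrite !inE eqxx.
have triple_slots c : triple c -> [/\ kap c.1.1 != kap c.1.2,
     kap c.1.1 != kap c.2 & kap c.1.2 != kap c.2].
  case/andP => /andP[_]; rewrite inE => /andP[_ e1] /and3P[]; rewrite inE => /andP[_ e2] _ ->.
  by split => //; exact: e_slot.
have pwr c : triple c -> pattern_weight slot P beta (inr c) = weight c.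
  move=> /triple_slots[n1 n2 n3]; rewrite /pattern_weight /P.
  rewrite big_setU1 ?big_setU1 ?big_set1 //= !inE //.
  by rewrite negb_or n1.
have [c|k|x [xA xP]] := @pattern_local_lemma R K T _ slot slot_neq0 D P val B tt mu beta lam
   beta_gt0 lam_gt0 P0.
- case: c => [v vY|c _] /=; last first.
    by rewrite big1 // => k _; rewrite /hit_prob setI0 cards0 mul0r.
  apply: (@le_trans _ _ (#|nbrs e Y v|%:R / q)); last by rewrite ler_pM2r ?invr_gt0 ?deg_le.
  rewrite -(sum_card_slot (nbrsY v)) natr_sum mulr_suml; apply: ler_sum => k _.
  by rewrite ler_wpM2l ?ler0n // lef_pV2 ?posrE.
- apply: le_trans small; rewrite big_sumType /=; apply: lerD.
    apply: (@le_trans _ _ (\sum_(v in Y) ((beta * #|slot (kap v)|%:R)^-1 * expR (- Lam)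
        * ((k == kap v)%:R + expR lam * (#|slot k :&: nbrs e Y v|%:R / #|slot k|%:R))))).
      apply: ler_sum => v vY; rewrite /pattern_weight /= big_set1 inE.
      apply: ler_wpM2r.
        by rewrite addr_ge0 ?mulr_ge0 ?ler0n ?expR_ge0 ?invr_ge0.
      apply: ler_wpM2l => //; rewrite ler_expR; exact: tail.
    under eq_bigr do rewrite mulrDr.
    rewrite big_split /=; apply: lerD.
      rewrite (bigID (fun v => kap v == k)) /= [X in _ + X]big1 ?addr0; last first.
        by move=> v /andP[_ /negbTE]; rewrite eq_sym => ->; rewrite mulr0.
      rewrite (eq_bigl (mem (slot k))); last by move=> v; rewrite !inE.
      rewrite (eq_bigr (fun=> (beta * #|slot k|%:R)^-1 * expR (- Lam))); last first.
        by move=> v vk; have : v \in slot k by []; rewrite inE => /andP[_ /eqP ->]; rewrite eqxx mulr1.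
      rewrite sumr_const -[_ *+ _]mulr_natr le_eqVlt; apply/orP; left; apply/eqP; field.
      by rewrite !gt_eqF ?slot_gt0.
    apply: (@le_trans _ _ (\sum_(v in Y) (beta * q)^-1 * expR (- Lam)
        * (expR lam * (#|slot k :&: nbrs e Y v|%:R / #|slot k|%:R)))).
      apply: ler_sum => v vY; apply: ler_wpM2r.
        by rewrite ?mulr_ge0 ?ler0n ?expR_ge0 ?invr_ge0.
      by apply: ler_wpM2r => //; rewrite expR_ge0.
    rewrite -!mulr_sumr -mulr_suml -natr_sum.
    under eq_bigr => v vY.
      rewrite (_ : slot k :&: nbrs e Y v = nbrs e (slot k) v); last first.
        by apply/setP => w; rewrite !inE; case: (w \in Y); case: (kap w == k).
    over.
    rewrite (sum_card_nbrs _ _ e_sym) natr_sum expRD.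
    have s_le : (\sum_(w in slot k) #|nbrs e Y w|%:R) / #|slot k|%:R <= Fmax.
      rewrite ler_pdivrMr // mulr_natr -sumr_const; apply: ler_sum => w.
      rewrite inE => /andP[wY _]; exact: le_trans (deg_le wY) (F_le wY).
    have c_ge0 : 0 <= (beta * q)^-1 * (expR (- Lam) * expR lam).
      by rewrite mulr_ge0 ?invr_ge0 ?mulr_ge0 ?expR_ge0 // ltW.
    rewrite [leLHS](_ : _ = (beta * q)^-1 * (expR (- Lam) * expR lam) *
      ((\sum_(w in slot k) #|nbrs e Y w|%:R) / #|slot k|%:R)); last by ring.
    apply: (le_trans (ler_wpM2l c_ge0 s_le)).
    rewrite le_eqVlt; apply/orP; left; apply/eqP; field.
    by rewrite !gt_eqF.
  apply: (@le_trans _ _ (\sum_(c | triple c)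
      (weight c * (kap c.1.1 == k)%:R + weight c * (kap c.1.2 == k)%:R
       + weight c * (kap c.2 == k)%:R))).
    apply: ler_sum => c tc; rewrite pwr // /tt /mu !mulr0 subr0 expR0 mulr1.
    rewrite /hit_prob setI0 cards0 mul0r mulr0 addr0 -!mulrDr; apply: ler_wpM2l.
      by rewrite !mulr_ge0.
    rewrite !inE !(eq_sym k) -!natrD ler_nat.
    by case: (_ == k); case: (_ == k); case: (_ == k).
  rewrite !big_split /=.
  have ind (Phi : pred (T * T * T)) : \sum_(c | triple c) weight c * (Phi c)%:R
      = \sum_(c | triple c && Phi c) weight c.
    by rewrite [RHS]big_mkcondr; apply: eq_bigr => c _; case: (Phi c); rewrite ?mulr1 ?mulr0.
  rewrite (ind (fun c => kap c.1.1 == k)) (ind (fun c => kap c.1.2 == k)).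
  rewrite (ind (fun c => kap c.2 == k)).
  have bound2 c : triple c -> kap c.1.2 == k ->
     weight c <= (beta * #|slot k|%:R)^-1 * ((beta * q)^-1 * (beta * q)^-1).
    move=> _ /eqP ck; rewrite /weight ck mulrCA.
    by apply: ler_wpM2l => //; apply: ler_pM.
  have bound1 : \sum_(c | triple c && (kap c.1.1 == k)) weight c
      <= Fmax * L / (q ^+ 2 * beta ^+ 3).
    apply: (@triple_sum (fun c => kap c.1.1 == k) k).
      exact: (@triple_count (fun c => kap c.1 == k) k (first_count k)).
    move=> c _ /eqP ck; rewrite /weight ck.
    by apply: ler_wpM2l => //; apply: ler_pM.
  have bound2' : \sum_(c | triple c && (kap c.1.2 == k)) weight c
      <= Fmax * L / (q ^+ 2 * beta ^+ 3).
    apply: (@triple_sum (fun c => kap c.1.2 == k) k) => //.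
    exact: (@triple_count (fun c => kap c.2 == k) k (second_count k)).
  have bound3 : \sum_(c | triple c && (kap c.2 == k)) weight c
      <= Fmax * L / (q ^+ 2 * beta ^+ 3).
    rewrite (reindex_inj (h := fun c : T * T * T => (c.1.1, c.2, c.1.2))) /=; last first.
      by move=> [[u w] w'] [[u' w1] w1'] /= [-> -> ->].
    rewrite (eq_bigl (fun c => triple c && (kap c.1.2 == k))).
      by apply: le_trans bound2'; apply: ler_sum => c _; rewrite /weight /= [X in _ * X]mulrC.
    move=> c; rewrite /triple /pair_ok /third /= (eq_sym (p c.2)) (eq_sym (kap c.2)).
    by case: (c.1.1 \in Y) => //=; case: (_ \in _); case: (_ \in _); rewrite ?andbF.
  lra.
- pose X := x @: [set: K].
  have xslot i : x i \in Y /\ kap (x i) = i.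
    by have := xA i; rewrite inE => /andP[-> /eqP].
  have Xin w : (w \in X) = (w \in Y) && (x (kap w) == w).
    apply/imsetP/andP => [[i _ ->]|[_ /eqP <-]]; last by exists (kap w).
    by have [-> ->] := xslot i; rewrite eqxx.
  have XY : X \subset Y by apply/subsetP => w; rewrite Xin => /andP[].
  exists X; split=> //.
  + move=> k; apply/eqP/cards1P; exists (x k); apply/setP => w.
    rewrite !inE Xin; apply/andP/eqP => [[/andP[_ /eqP xw] /andP[_ /eqP kw]]|->].
      by rewrite -kw.
    by have [-> ->] := xslot k; rewrite !eqxx.
  + move=> v; rewrite Xin => /andP[vY /eqP xv].
    have pat j : j \in P (inl v) -> x j = v by rewrite inE => /eqP ->.
    apply: le_lt_trans (xP (inl v) vY pat); rewrite ler_nat /= /B.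
    rewrite -(card_in_imset (f := kap)); last first.
      move=> w w'; rewrite !inE !Xin => /andP[/andP[_ /eqP xw] _] /andP[/andP[_ /eqP xw'] _].
      by move=> kk; rewrite -xw -xw' kk.
    apply: subset_leq_card; apply/subsetP => _ /imsetP[w wN ->].
    move: wN; rewrite !inE Xin => /andP[/andP[wY /eqP ->] evw].
    by rewrite wY evw eq_sym e_slot.
  + move=> v vX i; apply/card_le1_eqP => w w'; rewrite !inE.
    move=> /andP[/andP[wX evw] /eqP pw] /andP[/andP[w'X evw'] /eqP pw'].
    move: vX wX w'X; rewrite !Xin => /andP[vY /eqP xv] /andP[wY /eqP xw] /andP[w'Y /eqP xw'].
    apply/eqP/negPn/negP => ww'.
    have tc : triple (v, w, w').
      rewrite /triple /pair_ok /third /= !inE vY wY w'Y evw evw' pw pw' eqxx /=.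
      by apply: contra ww' => /eqP kk; rewrite -xw -xw' kk.
    have [n1 n2 n3] := triple_slots _ tc.
    have pat j : j \in P (inr (v, w, w')) -> x j = val (inr (v, w, w')) j.
      rewrite !inE /val /= => /or3P[] /eqP ->; first by rewrite eqxx.
        by rewrite eq_sym (negbTE n1) eqxx.
      by rewrite eq_sym (negbTE n2) eq_sym (negbTE n3).
    by have := xP (inr (v, w, w')) tc pat; rewrite ltNge ler0n.
Qed.
End Sampling.

(** * Choosing vertices for one block *)

Section Stage.
Variables (R : realType) (I J T : finType) (e : rel T) (p : T -> I) (cls : T -> J).
Variables (Z : {set T}) (S later : {set I}) (x0 : T).
Variables (N0 d1 d2 lam beta Lam : R) (m t : I -> J -> R).

Definition part (j : I) : {set T} := [set u in Z | p u == j].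
Definition cell (i : I) (c : J) : {set T} := [set u in Z | (p u == i) && (cls u == c)].
Let ZS : {set T} := [set u in Z | p u \in S].

Hypothesis e_sym : symmetric e.
Hypothesis e_part : forall v w, e v w -> p v != p w.
Hypotheses (lam_gt0 : 0 < lam) (beta_gt0 : 0 < beta) (N0_gt0 : 0 < N0).
Hypotheses (d1_ge0 : 0 <= d1) (d2_ge0 : 0 <= d2).
Hypothesis part_ge : {in S, forall j, N0 <= #|part j|%:R}.
Hypothesis deg_now : {in Z, forall u, #|nbrs e ZS u|%:R <= d1}.
Hypothesis deg_all : {in Z, forall u, #|nbrs e Z u|%:R <= d2}.
Hypothesis cell_le : {in later, forall i c,
  \sum_(u in cell i c) #|nbrs e ZS u|%:R <= m i c}.
Hypothesis t_gt0 : {in later, forall i c, 0 < t i c}.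
Hypothesis tail : {in later, forall i c,
  (expR lam - 1) / beta * (m i c / N0) - lam * t i c <= - Lam}.
Hypothesis small :
  2%:R * (d1 / (beta ^+ 2 * N0)) + d2 * expR (lam - Lam) <= 1 - beta.

Let part_gt0 j : j \in S -> 0 < #|part j|%:R :> R.
Proof. by move=> jS; apply: lt_le_trans (part_ge jS). Qed.

(** The parts indexed by S choose among their vertices in Z.  Edges between
    two choices are forbidden as patterns, which costs little since the
    degree d1 into the block is small compared with the number N0 of available
    vertices; the number of choices adjacent to a cell of a later part is
    bounded by a tail estimate. *)
Lemma stage : exists y : I -> T, [/\
  {in S, forall j, y j \in Z /\ p (y j) = j},
  {in S &, forall j j', ~~ e (y j) (y j')} &
  {in later, forall i c,
    #|[set j in S | [exists u in cell i c, e u (y j)]]|%:R < t i c}].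
Proof.
pose A j := if j \in S then part j else [set x0].
have A0 j : A j != set0.
  rewrite /A; case: ifP => [/part_gt0|_]; first by rewrite ltr0n card_gt0.
  by apply/set0Pn; exists x0; rewrite inE.
pose edge (c : T * T) := (c.1 \in ZS) && (c.2 \in nbrs e ZS c.1).
pose D (c : T * T + I * J) := match c with inl c => edge c | inr c => c.1 \in later end.
pose P (c : T * T + I * J) : {set I} :=
  match c with inl c => p c.1 |: [set p c.2] | inr _ => set0 end.
pose val (c : T * T + I * J) j :=
  match c with inl c => if j == p c.1 then c.1 else c.2 | inr _ => x0 end.
pose hit (c : I * J) := [set x | [exists u in cell c.1 c.2, e u x]].
pose B (c : T * T + I * J) j :=
  match c with inl _ => set0 | inr c => if j \in S then hit c else set0 end.
pose tt (c : T * T + I * J) : R := match c with inl _ => 0 | inr c => t c.1 c.2 end.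
pose mu (c : T * T + I * J) : R := match c with inl _ => 0 | inr c => m c.1 c.2 / N0 end.
have tt_gt0 c : D c -> P c = set0 -> 0 < tt c.
  case: c => [c _ P0|c cL _]; last exact: t_gt0.
  by move/setP/(_ (p c.1)): P0; rewrite !inE eqxx.
have edge_part c : edge c -> p c.1 != p c.2.
  by case/andP=> _; rewrite inE => /andP[_ /e_part].
have [c|k|x [xA xP]] := @pattern_local_lemma R I T _ A A0 D P val B tt mu beta lam
   beta_gt0 lam_gt0 tt_gt0.
- case: c => [c _|c cL] /=.
    by rewrite big1 // => k _; rewrite /hit_prob setI0 cards0 mul0r.
  apply: (@le_trans _ _ ((\sum_(u in cell c.1 c.2) #|nbrs e ZS u|%:R) / N0)); last first.
    by rewrite ler_pM2r ?invr_gt0 //; apply: cell_le.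
  have -> : \sum_(u in cell c.1 c.2) #|nbrs e ZS u|%:R
     = \sum_(w in ZS) #|nbrs e (cell c.1 c.2) w|%:R :> R.
    by rewrite -!natr_sum (sum_card_nbrs _ _ e_sym).
  apply: (@le_trans _ _ ((\sum_(w in ZS | w \in hit c) 1) / N0)); last first.
    rewrite ler_pM2r ?invr_gt0 // big_mkcondr /=; apply: ler_sum => w _.
    rewrite inE; case: existsP => // -[u /andP[uc euw]].
    rewrite ler1n card_gt0; apply/set0Pn; exists u; by rewrite inE uc e_sym.
  rewrite (partition_big p (mem S)) /=; last by move=> w /andP[]; rewrite inE => /andP[].
  rewrite mulr_suml [leRHS]big_mkcond /=; apply: ler_sum => j _.
  rewrite /hit_prob /A /B; case: ifP => jS; last by rewrite setI0 cards0 mul0r.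
  have -> : \sum_(w | (w \in ZS) && (w \in hit c) && (p w == j)) 1
      = #|part j :&: hit c|%:R :> R.
    rewrite -sum1_card natr_sum; apply: eq_bigl => w; rewrite !inE.
    case: eqP => [->|]; rewrite ?andbF ?andbT //=; by rewrite jS andbT.
  by rewrite ler_wpM2l // lef_pV2 ?posrE ?part_gt0 // part_ge.
- apply: le_trans small; rewrite big_sumType /=; apply: lerD.
    pose W (c : T * T) : R := (beta * #|A (p c.1)|%:R)^-1 * (beta * #|A (p c.2)|%:R)^-1.
    have W_ge0 c : 0 <= W c.
      by rewrite mulr_ge0 // invr_ge0 mulr_ge0 // ltW.
    have half : \sum_(c | edge c) W c * (p c.1 == k)%:R <= d1 / (beta ^+ 2 * N0).
      case kS: (k \in S); last first.
        rewrite big1; first by rewrite divr_ge0 ?mulr_ge0 ?sqr_ge0 // ltW.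
        move=> c /andP[]; rewrite inE => /andP[_ cS] _.
        by case: eqP => [pk|]; rewrite ?mulr0 //; rewrite pk kS in cS.
      apply: (@le_trans _ _ (\sum_(c | (c.1 \in part k) && (c.2 \in nbrs e ZS c.1))
          (beta * #|part k|%:R)^-1 * (beta * N0)^-1)).
        rewrite (bigID (fun c => p c.1 == k)) /= [X in _ + X]big1 ?addr0; last first.
          by move=> c /andP[_ /negbTE ->]; rewrite mulr0.
        rewrite [leRHS](eq_bigl (fun c => edge c && (p c.1 == k))); last first.
          move=> c; rewrite /edge !inE; case: eqP => [->|_]; rewrite ?andbF // kS.
          by rewrite !andbT.
        apply: ler_sum => c /andP[ec /eqP pk]; rewrite pk eqxx mulr1 /W pk /A kS.
        apply: ler_wpM2l; first by rewrite invr_ge0 mulr_ge0 // ltW.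
        have pS : p c.2 \in S by move: ec; rewrite /edge !inE => /and3P[_ /andP[]].
        by rewrite pS lef_pV2 ?posrE ?mulr_gt0 ?part_gt0 // ler_pM2l // part_ge.
      rewrite -(pair_big_dep (mem (part k)) (fun v w => w \in nbrs e ZS v)
           (fun _ _ => (beta * #|part k|%:R)^-1 * (beta * N0)^-1)) /=.
      under eq_bigr do rewrite sumr_const -[_ *+ #|_|]mulr_natr.
      rewrite -mulr_sumr.
      have s_le : \sum_(v in part k) #|nbrs e ZS v|%:R <= #|part k|%:R * d1.
        rewrite mulr_natl -sumr_const; apply: ler_sum => v; rewrite inE => /andP[vZ _].
        exact: deg_now.
      apply: le_trans (ler_wpM2l _ s_le) _.
        by rewrite mulr_ge0 // invr_ge0 mulr_ge0 // ltW.
      rewrite le_eqVlt; apply/orP; left; apply/eqP; field.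
      by rewrite !gt_eqF ?part_gt0.
    have half' : \sum_(c | edge c) W c * (p c.2 == k)%:R <= d1 / (beta ^+ 2 * N0).
      apply: le_trans half.
      rewrite (reindex_inj (h := fun c : T * T => (c.2, c.1))) /=; last first.
        by move=> [u w] [u' w'] /= [-> ->].
      rewrite le_eqVlt; apply/orP; left; apply/eqP; apply: eq_big => c; last first.
        by rewrite /W /= [X in X * _]mulrC.
      by rewrite /edge !inE /= e_sym; case: (e c.1 c.2); rewrite ?andbF ?andbT // andbC.
    apply: (@le_trans _ _ (\sum_(c | edge c)
        (W c * (p c.1 == k)%:R + W c * (p c.2 == k)%:R))); last first.
      by rewrite big_split /=; lra.
    apply: ler_sum => c ec; rewrite /tt /mu !mulr0 subr0 expR0 mulr1.
    rewrite /hit_prob setI0 cards0 mul0r mulr0 addr0 /pattern_weight /P.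
    rewrite big_setU1 ?inE ?edge_part //= big_set1 -mulrDr; apply: ler_wpM2l; first exact: W_ge0.
    rewrite !(eq_sym k) -natrD ler_nat.
    by case: (_ == k); case: (_ == k).
  apply: (@le_trans _ _ (\sum_(c : I * J | c.1 \in later)
      expR (- Lam) * (expR lam * hit_prob R A B (inr c) k))).
    apply: ler_sum => c cL; rewrite /pattern_weight big_set0 mul1r inE add0r.
    apply: ler_wpM2r; first by rewrite mulr_ge0 ?expR_ge0 ?hit_prob_ge0.
    by rewrite ler_expR; apply: tail.
  rewrite -!mulr_sumr [lam - Lam]addrC expRD [leRHS]mulrC -[leRHS]mulrA.
  rewrite !ler_wpM2l ?expR_ge0 //.
  rewrite /hit_prob /A /B; case kS: (k \in S); last first.
    by rewrite big1 // => c _; rewrite setI0 cards0 mul0r.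
  rewrite -mulr_suml ler_pdivrMr ?part_gt0 // mulr_natr -sumr_const.
  have card_hit c : #|part k :&: hit c|%:R = \sum_(w in part k) (w \in hit c)%:R :> R.
    rewrite -sum1_card natr_sum big_mkcond [RHS]big_mkcond /=; apply: eq_bigr => w _.
    by rewrite in_setI; case: (w \in part k); case: (w \in hit c).
  under eq_bigr do rewrite card_hit.
  rewrite exchange_big /=; apply: ler_sum => w; rewrite inE => /andP[wZ _].
  apply: le_trans (deg_all wZ); rewrite -natr_sum ler_nat.
  apply: leq_trans (leq_imset_card (fun u => (p u, cls u)) _).
  rewrite -sum1_card big_mkcond [leqRHS]big_mkcond /=; apply: leq_sum => -[i c] _ /=.
  case: ifP => // _; rewrite inE; case: existsP => // -[u /andP[uc euw]].
  move: uc; rewrite inE /= => /and3P[uZ /eqP pu /eqP cu].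
  rewrite (_ : _ \in _) //; apply/imsetP; exists u; last by rewrite pu cu.
  by rewrite inE uZ e_sym.
- exists x; split.
  + by move=> j jS; have := xA j; rewrite /A jS inE => /andP[-> /eqP].
  + move=> j j' jS j'S; apply/negP => ejj.
    have := xA j; rewrite /A jS inE => /andP[jZ /eqP pj].
    have := xA j'; rewrite /A j'S inE => /andP[j'Z /eqP pj'].
    have ec : edge (x j, x j') by rewrite /edge !inE jZ j'Z pj pj' jS j'S ejj.
    have pat i : i \in P (inl (x j, x j')) -> x i = val (inl (x j, x j')) i.
      rewrite !inE /val /= pj pj' => /orP[] /eqP ->; first by rewrite eqxx.
      by case: eqP => // ->.
    by have := xP (inl (x j, x j')) ec pat; rewrite ltNge ler0n.
  + move=> i iL c.
    have pat j : j \in P (inr (i, c)) -> x j = val (inr (i, c)) j by rewrite inE.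
    apply: le_lt_trans (xP (inr (i, c)) iL pat); rewrite ler_nat subset_leq_card //.
    by apply/subsetP => j; rewrite !inE /= /B => /andP[-> ex]; rewrite inE.
Qed.
End Stage.

(** * Running through all the blocks *)

(** As a function of x, the right-hand side is convex where its factors are
    nonnegative; the left-hand side is its tangent at theta.  Each induction
    step multiplies by one more affine factor and discards a nonnegative
    multiple of (x - theta) ^+ 2. *)
Lemma prod_ge_tangent (R : realFieldType) (f : nat -> R) (theta x : R) (s : nat) :
  (forall j, (j < s)%N -> [/\ 0 <= f j, f j * theta < 1 & f j * x <= 1]) ->
  (\prod_(j < s) (1 - f j * theta)) * (1 - (\sum_(j < s) f j / (1 - f j * theta)) * (x - theta))
    <= \prod_(j < s) (1 - f j * x).
Proof.
elim: s => [|s IHs] H; first by rewrite !big_ord0 mul0r subr0 mulr1.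
have [f0 ft fx] := H s (ltnSn s).
rewrite !big_ord_recr /=.
have {}IHs := IHs (fun j js => H j (ltnW js)).
set p := \prod_(i < s) _ in IHs *; set sg := \sum_(i < s) _ in IHs *.
have p_ge0 : 0 <= p.
  apply: prodr_ge0 => j _; have [_ ? _] := H j (leq_trans (ltn_ord j) (leqnSn s)).
  by rewrite subr_ge0 ltW.
have sg_ge0 : 0 <= sg.
  apply: sumr_ge0 => j _; have [? ? _] := H j (leq_trans (ltn_ord j) (leqnSn s)).
  by rewrite divr_ge0 // subr_ge0 ltW.
have d_gt0 : 0 < 1 - f s * theta by rewrite subr_gt0.
apply: le_trans (ler_wpM2r _ IHs); last by rewrite subr_ge0.
have -> : 1 - f s * x = (1 - f s * theta) * (1 - f s / (1 - f s * theta) * (x - theta)).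
  by field; rewrite gt_eqF.
set d := 1 - f s * theta in d_gt0 *; set c := f s / d.
have c_ge0 : 0 <= c by rewrite divr_ge0 // ltW.
rewrite -subr_ge0.
have -> : p * (1 - sg * (x - theta)) * (d * (1 - c * (x - theta)))
   - p * d * (1 - (sg + c) * (x - theta)) = p * d * (sg * c * (x - theta) ^+ 2).
  by ring.
have d_ge0 := ltW d_gt0.
by apply: mulr_ge0; apply: mulr_ge0 => //; [apply: mulr_ge0 | apply: sqr_ge0].
Qed.

Section Iteration.
Variables (R : realType) (I T : finType) (Q nb l : nat) (e : rel T) (p : T -> I).
Variables (cls : T -> 'I_Q) (X : {set T}) (r : I -> 'I_nb) (chi : I -> 'I_Q -> R).
Variables (theta K b lam beta mu delta amin : R).

Let n : R := Q%:R * l%:R.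
(* a s is the guaranteed fraction of available vertices after s stages, and
   surv s x the fraction of a class of degree x n that survives them. *)
Let a (s : nat) : R := 1 - s%:R * (b * theta).
Let surv (s : nat) (x : R) : R := \prod_(j < s) (1 - b / a j * x).

Hypotheses (e_sym : symmetric e) (e_part : forall v w, e v w -> p v != p w).
Hypothesis cell_card : forall i c, #|cell p cls X i c| = l.
Hypothesis local1 : {in X, forall u i, (#|[set w in nbrs e X u | p w == i]| <= 1)%N}.
Hypothesis block_deg : {in X, forall u s,
  #|[set w in nbrs e X u | r (p w) == s]|%:R <= chi (p u) (cls u) * n / nb%:R}.
Hypothesis chi_ge0 : forall i c, 0 <= chi i c.
Hypothesis chi_le : forall i c, chi i c <= K.
Hypothesis chi_avg : forall i, \sum_c chi i c <= Q%:R * theta.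
Hypotheses (nb_gt0 : (0 < nb)%N) (Q_gt0 : (0 < Q)%N) (l_gt0 : (0 < l)%N).
Hypotheses (lam_gt0 : 0 < lam) (beta_gt0 : 0 < beta) (mu_gt0 : 0 < mu) (mu_lt1 : mu < 1).
Hypotheses (b_ge0 : 0 <= b) (theta_ge0 : 0 <= theta).
Hypotheses (amin_gt0 : 0 < amin) (amin_le : amin <= a nb).
Hypothesis delta_gt0 : 0 < delta.
Hypothesis rate : (expR lam - 1) / beta <= lam * b * nb%:R * (1 - mu).
Hypothesis bK : b * K <= amin.
Hypothesis slack : nb%:R * delta <= mu * amin.
Hypothesis small : 2%:R * (K * n / nb%:R / (beta ^+ 2 * (n * amin * (1 - mu))))
   + K * n * expR (lam - lam * (delta * l%:R)) <= 1 - beta.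

Let n_gt0 : 0 < n.
Proof. by rewrite /n mulr_gt0 ?ltr0n. Qed.

Let a_ge s : (s <= nb)%N -> amin <= a s.
Proof.
move=> snb; apply: le_trans amin_le _; rewrite lerD2l lerN2.
by rewrite ler_wpM2r ?mulr_ge0 // ler_nat.
Qed.

Let a_gt0 s : (s <= nb)%N -> 0 < a s.
Proof. by move=> /a_ge; apply: lt_le_trans. Qed.

Let K_ge0 : I -> 0 <= K.
Proof. by move=> i; apply: le_trans (chi_ge0 i (Ordinal Q_gt0)) (chi_le _ _). Qed.

Let kill_frac s i c : (s <= nb)%N -> 0 <= b / a s * chi i c <= 1.
Proof.
move=> snb; rewrite !mulr_ge0 ?invr_ge0 ?(ltW (a_gt0 snb)) //=.
rewrite mulrAC ler_pdivrMr ?a_gt0 // mul1r.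
apply: le_trans (a_ge snb); apply: le_trans bK.
exact: ler_wpM2l.
Qed.

Let a_ratio j : (j < nb)%N -> 1 - b / a j * theta = a j.+1 / a j.
Proof.
move=> jn; have aj := a_gt0 (ltnW jn).
by rewrite /a -natr1; field; rewrite gt_eqF.
Qed.

(** Jensen's inequality for the survival function.  At the average theta it
    telescopes, because 1 - b theta / a j = a (j + 1) / a j. *)
Lemma surv_sum s i : (s <= nb)%N -> Q%:R * a s <= \sum_c surv s (chi i c).
Proof.
move=> snb.
have tele : \prod_(j < s) (1 - b / a j * theta) = a s.
  elim: s snb => [|s IH] snb; first by rewrite big_ord0 /a mul0r subr0.
  rewrite big_ord_recr /= IH ?(ltnW snb) // a_ratio // mulrC divfK //.
  by rewrite gt_eqF // a_gt0 // ltnW.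
pose sg := \sum_(j < s) (b / a j) / (1 - b / a j * theta).
have cond c j : (j < s)%N ->
    [/\ 0 <= b / a j, b / a j * theta < 1 & b / a j * chi i c <= 1].
  move=> js; have jn := leq_trans js snb; have aj := a_gt0 (ltnW jn).
  split; first by rewrite divr_ge0 // ltW.
    by rewrite -subr_gt0 a_ratio // divr_gt0 // a_gt0.
  by have /andP[] := kill_frac i c (ltnW jn).
have sg_ge0 : 0 <= sg.
  apply: sumr_ge0 => j _; have [? ? _] := cond (Ordinal Q_gt0) j (ltn_ord j).
  by rewrite divr_ge0 // subr_ge0 ltW.
apply: (@le_trans _ _ (\sum_c a s * (1 - sg * (chi i c - theta)))); last first.
  by apply: ler_sum => c _; rewrite -tele; apply: (prod_ge_tangent (cond c)).
rewrite -mulr_sumr mulrC ler_wpM2l ?(ltW (a_gt0 snb)) //.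
rewrite sumrB -mulr_sumr sumrB !sumr_const card_ord -[theta *+ _]mulr_natl.
by rewrite lerBrDr -lerBrDl subrr mulr_ge0_le0 // subr_le0.
Qed.

Let alive (Y : {set T}) s : {set T} :=
  [set u in X | (s <= r (p u))%N && [forall w in Y, ~~ e u w]].

(** Y is the independent set chosen in the first s blocks.  The additive loss
    delta l per stage is the slack of the tail bounds; it accumulates only
    linearly because the surviving fractions are at most 1. *)
Lemma iteration (x0 : T) s : (s <= nb)%N -> exists Y : {set T}, [/\
   Y \subset X, {in Y &, forall u w, ~~ e u w},
   (forall u, u \in Y -> (r (p u) < s)%N),
   (forall i, (r i < s)%N -> #|[set u in Y | p u == i]| = 1%N) &
   forall i, (s <= r i)%N -> forall c,
     l%:R * surv s (chi i c) - s%:R * delta * l%:R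
        <= #|cell p cls (alive Y s) i c|%:R].
Proof.
elim: s => [|s IHs] snb.
  exists set0; split; rewrite ?sub0set //.
  - by move=> u w; rewrite inE.
  - by move=> u; rewrite inE.
  - move=> i _ c; rewrite /surv big_ord0 mulr1 !mul0r subr0 -(cell_card i c) ler_nat.
    apply: subset_leq_card; apply/subsetP => u; rewrite !inE => /andP[-> ->].
    by rewrite andbT /=; apply/forall_inP => w; rewrite inE.
have [Y [YX Yind Yr Y1 Ycell]] := IHs (ltnW snb).
pose Z := alive Y s.
pose S := [set i | r i == s :> nat]; pose later := [set i | (s < r i)%N].
have ZX : Z \subset X by apply/subsetP => u; rewrite inE => /andP[].
have as_gt0 := a_gt0 (ltnW snb).
pose N0 := n * a s * (1 - mu).
have N0_gt0 : 0 < N0.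
  by rewrite /N0; apply: mulr_gt0; [apply: mulr_gt0 | rewrite subr_gt0].
have part_ge : {in S, forall j, N0 <= #|part p Z j|%:R}.
  move=> j; rewrite inE => /eqP rj.
  have -> : #|part p Z j| = (\sum_c #|cell p cls Z j c|)%N.
    rewrite -sum1_card (partition_big cls xpredT) //=; apply: eq_bigr => c _.
    by rewrite sum1dep_card; apply: eq_card => u; rewrite !inE -!andbA.
  rewrite natr_sum.
  have rj' : (s <= r j)%N by rewrite rj.
  apply: le_trans (ler_sum _ (fun c _ => Ycell j rj' c)).
  rewrite sumrB -mulr_sumr sumr_const card_ord -[_ *+ Q]mulr_natl.
  apply: (@le_trans _ _ (l%:R * (Q%:R * a s) - Q%:R * (s%:R * delta * l%:R))); last first.
    by rewrite lerD2r ler_wpM2l ?ler0n // surv_sum // ltnW.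
  have -> : l%:R * (Q%:R * a s) - Q%:R * (s%:R * delta * l%:R) = n * (a s - s%:R * delta).
    by rewrite /n; ring.
  rewrite /N0 -mulrA ler_wpM2l ?(ltW n_gt0) // mulrBr mulr1 lerD2l lerN2.
  apply: (@le_trans _ _ (nb%:R * delta)).
    by rewrite ler_wpM2r ?(ltW delta_gt0) // ler_nat ltnW.
  apply: le_trans slack _; rewrite mulrC ler_wpM2r ?(ltW mu_gt0) //.
  by apply: a_ge; apply: ltnW.
have blk u : u \in X -> #|nbrs e [set w in Z | p w \in S] u|%:R
     <= chi (p u) (cls u) * n / nb%:R.
  move=> uX; apply: le_trans (block_deg uX (Ordinal snb)).
  rewrite ler_nat subset_leq_card //; apply/subsetP => w.
  rewrite !inE => /andP[/andP[/andP[-> _] rw] ->] /=; exact: rw.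
have nbR : 0 < nb%:R :> R by rewrite ltr0n.
have deg u : u \in X -> #|nbrs e X u|%:R <= K * n.
  move=> uX; have -> : #|nbrs e X u| =
      (\sum_(s' < nb) #|[set w in nbrs e X u | r (p w) == s']|)%N.
    rewrite -sum1_card (partition_big (fun w => r (p w)) xpredT) //=.
    by apply: eq_bigr => s' _; rewrite sum1dep_card.
  rewrite natr_sum; apply: le_trans (ler_sum _ (fun s' _ => block_deg uX s')) _.
  rewrite sumr_const card_ord -[_ *+ nb]mulr_natr divfK ?gt_eqF //.
  by rewrite ler_wpM2r ?(ltW n_gt0).
pose t i c := #|cell p cls Z i c|%:R * (b / a s * chi i c) + delta * l%:R.
have dl_gt0 : 0 < delta * l%:R by rewrite mulr_gt0 ?ltr0n.
have K0 : 0 <= K := K_ge0 (p x0).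
have [|||||i iL c|i iL c|i iL c||y [yZ yind yhit]] := @stage R I 'I_Q T e p cls Z S later x0 N0
   (K * n / nb%:R) (K * n) lam beta (lam * (delta * l%:R))
   (fun i c => #|cell p cls Z i c|%:R * (chi i c * n / nb%:R)) t
   e_sym e_part lam_gt0 beta_gt0 N0_gt0.
- by rewrite divr_ge0 ?mulr_ge0 // ltW.
- by rewrite mulr_ge0 // ltW.
- exact: part_ge.
- move=> u uZ; apply: le_trans (blk u (subsetP ZX u uZ)) _.
  by rewrite ler_wpM2r ?invr_ge0 ?(ltW nbR) // ler_wpM2r ?(ltW n_gt0).
- move=> u uZ; apply: le_trans (deg u (subsetP ZX u uZ)).
  by rewrite ler_nat subset_leq_card //; apply/subsetP => w; rewrite !inE => /andP[/andP[->]].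
- rewrite mulr_natl -sumr_const; apply: ler_sum => u; rewrite inE => /and3P[uZ /eqP <- /eqP <-].
  exact: blk (subsetP ZX u uZ).
- rewrite /t ltr_wpDl // mulr_ge0 ?ler0n //.
  by have /andP[] := kill_frac i c (ltnW snb).
- have [C_ge0 c0] : 0 <= #|cell p cls Z i c|%:R :> R /\ 0 <= chi i c by split.
  have mu1 : 0 < 1 - mu by rewrite subr_gt0.
  have w_ge0 : 0 <= #|cell p cls Z i c|%:R * chi i c / (nb%:R * a s * (1 - mu)).
    by rewrite divr_ge0 ?mulr_ge0 // ltW.
  have := ler_wpM2r w_ge0 rate.
  rewrite [X in _ <= X -> _](_ : _ = lam * (#|cell p cls Z i c|%:R * (b / a s * chi i c))); last first.
    by field; rewrite !gt_eqF.
  rewrite [X in X <= _ -> _](_ : _ = (expR lam - 1) / beta *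
     (#|cell p cls Z i c|%:R * (chi i c * n / nb%:R) / N0)); last first.
    by rewrite /N0; field; rewrite ?gt_eqF //= ltr0n.
  by rewrite /t mulrDr; lra.
- apply: le_trans small; rewrite lerD2r ler_wpM2l ?ler0n //.
  have mu1 : 0 < 1 - mu by rewrite subr_gt0.
  apply: ler_wpM2l; first by rewrite divr_ge0 ?mulr_ge0 // ltW.
  rewrite lef_pV2 ?posrE ?mulr_gt0 ?exprn_gt0 ?ltr0n //.
  rewrite ler_wpM2l ?sqr_ge0 // /N0 ler_wpM2r ?(ltW mu1) // ler_wpM2l ?(ltW n_gt0) //.
  by apply: a_ge; apply: ltnW.
have yS j : r j = s :> nat -> [/\ y j \in Z, y j \in X, p (y j) = j & {in Y, forall w, ~~ e (y j) w}].
  move=> rj; have jS : j \in S by rewrite inE rj.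
  have [yjZ pj] := yZ j jS; split=> //; first exact: (subsetP ZX).
  by move: yjZ; rewrite inE => /and3P[_ _ /forall_inP].
pose Y' := Y :|: [set y j | j in S].
have Y'P u : u \in Y' -> u \in Y \/ exists2 j, r j = s :> nat & u = y j.
  rewrite inE => /orP[|/imsetP[j]]; first by left.
  by rewrite inE => /eqP rj ->; right; exists j.
exists Y'; split.
- by apply/subsetP => u /Y'P[/(subsetP YX)//|[j /yS[]] _ ? _ _ ->].
- move=> u w /Y'P[uY|[j rj ->]] /Y'P[wY|[j' rj' ->]]; first exact: Yind.
  + by rewrite e_sym; have [_ _ _] := yS j' rj'; apply.
  + by have [_ _ _] := yS j rj; apply.
  + by apply: yind; rewrite inE ?rj ?rj'.
- move=> u /Y'P[/Yr /ltnW//|[j rj ->]].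
  by have [_ _ -> _] := yS j rj; rewrite rj.
- move=> i; rewrite ltnS leq_eqVlt => /orP[/eqP ri|ri].
    apply/eqP/cards1P; exists (y i); apply/setP => u; rewrite inE in_set1.
    apply/andP/eqP => [[/Y'P[/Yr|[j rj ->]]]|->].
      + by move=> lt /eqP pu; rewrite pu ri ltnn in lt.
      + by have [_ _ -> _] := yS j rj => /eqP ->.
    have [_ _ -> _] := yS i ri; rewrite eqxx; split=> //.
    by rewrite inE; apply/orP; right; apply: imset_f; rewrite inE ri.
  rewrite -(Y1 i ri); apply: eq_card => u; rewrite [in LHS]inE [in RHS]inE.
  case: eqP => [pu|]; rewrite ?andbF ?andbT //.
  apply/idP/idP => [/Y'P[//|[j rj uE]]|uY]; last by rewrite inE uY.
  by move: ri; rewrite -pu uE; have [_ _ -> _] := yS j rj; rewrite rj ltnn.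
move=> i ri c.
have iL : i \in later by rewrite inE.
pose hits := [set j in S | [exists u in cell p cls Z i c, e u (y j)]].
pose f j := odflt x0 [pick u in cell p cls Z i c | e u (y j)].
(* A chosen y j has at most one neighbour in the part i, so the vertices lost
   by a cell inject into the choices adjacent to it. *)
have sub : cell p cls Z i c \subset cell p cls (alive Y' s.+1) i c :|: f @: hits.
  apply/subsetP => u uc; rewrite inE.
  move: (uc); rewrite inE => /and3P[uZ pu cu].
  move: (uZ); rewrite inE => /and3P[uX _ /forall_inP uY].
  case ex : [exists j in S, e u (y j)].
    apply/orP; right; case/existsP: ex => j /andP[jS ej].
    apply/imsetP; exists j; first by rewrite inE jS; apply/existsP; exists u; rewrite uc.
    rewrite /f; case: pickP => [w /andP[wc ew]|/(_ u)]; last by rewrite uc ej.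
    have [_ yX _ _] : [/\ y j \in Z, y j \in X, p (y j) = j & {in Y, forall w, ~~ e (y j) w}].
      by apply: yS; move: jS; rewrite inE => /eqP.
    have /card_le1_eqP := local1 yX i; apply; rewrite !inE /=.
      by move: wc; rewrite inE => /and3P[/(subsetP ZX) -> -> _]; rewrite e_sym ew.
    by rewrite uX [e _ _]e_sym ej (eqP pu) eqxx.
  apply/orP; left; rewrite inE pu cu !andbT inE uX (eqP pu) ri /=.
  apply/forall_inP => w /Y'P[/uY//|[j rj ->]].
  move/existsPn/(_ j): ex; by rewrite inE rj eqxx.
have card_le : #|cell p cls Z i c|%:R <= #|cell p cls (alive Y' s.+1) i c|%:R + t i c.
  apply: (@le_trans _ _ (#|cell p cls (alive Y' s.+1) i c|%:R + #|hits|%:R)).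
    rewrite -natrD ler_nat; apply: leq_trans (subset_leq_card sub) _.
    by apply: leq_trans (leq_card_setU _ _) _; rewrite leq_add2l leq_imset_card.
  by rewrite lerD2l ltW // yhit.
have := Ycell i (ltnW ri) c; rewrite -/Z => Yc.
have /andP[k0 k1] := kill_frac i c (ltnW snb).
have fin : (1 - b / a s * chi i c) * (l%:R * surv s (chi i c) - s%:R * delta * l%:R)
    <= (1 - b / a s * chi i c) * #|cell p cls Z i c|%:R.
  by rewrite ler_wpM2l // subr_ge0.
have extra : 0 <= b / a s * chi i c * (s%:R * delta * l%:R).
  by rewrite mulr_ge0 // mulr_ge0 ?ler0n // mulr_ge0 ?ler0n // ltW.
rewrite /surv big_ord_recr /= -/(surv s (chi i c)) -natr1.
move: card_le fin extra; rewrite /t; lra.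
Qed.
End Iteration.

(** * Fixing the constants of the iteration *)

Lemma expR_subr1_le (R : realType) (x : R) : 0 < x -> x < 1 -> expR x - 1 <= x / (1 - x).
Proof.
move=> x0 x1; have d0 : 0 < 1 - x by rewrite subr_gt0.
have := expR_ge1Dx (- x); rewrite expRN => le.
have e0 := expR_gt0 x.
have : (1 - x) * expR x <= 1 by rewrite -ler_pdivlMr // mul1r.
by rewrite ler_pdivlMr //; lra.
Qed.

Lemma nat_above (R : realType) (x : R) : exists n : nat, forall m, (n <= m)%N -> x <= m%:R.
Proof.
exists (Num.bound `|x|) => m nm; apply: le_trans (ler_norm x) _.
apply: le_trans (ltW (archi_boundP (normr_ge0 x))) _; by rewrite ler_nat.
Qed.

(** Used to beat the polynomially many constraints per coordinate by their
    exponentially small weights: exp (c l) >= (c l / (k + 1)) ^ (k + 1). *)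
Lemma poly_exp_small (R : realType) (C c eta : R) (k : nat) :
  0 <= C -> 0 < c -> 0 < eta -> exists l0 : nat, forall l : nat, (l0 <= l)%N ->
    C * l%:R ^+ k * expR (- (c * l%:R)) <= eta.
Proof.
move=> C0 c0 eta0; pose M : R := k.+1%:R / c.
have M0 : 0 < M by rewrite divr_gt0 ?ltr0n.
have [l0 l0P] := nat_above (C * M ^+ k.+1 / eta); exists (maxn 1 l0) => l.
rewrite geq_max => /andP[l1 /l0P]; rewrite ler_pdivrMr // => le.
have lR : 0 < l%:R :> R by rewrite ltr0n.
have ex : (l%:R / M) ^+ k.+1 <= expR (c * l%:R).
  have -> : c * l%:R = k.+1%:R * (l%:R / M).
    by rewrite /M invf_div mulrCA [_ * (_ / _)]mulrCA divff ?pnatr_eq0 // mulr1 mulrC.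
  have lM : 0 <= l%:R / M by rewrite mulr_ge0 ?invr_ge0 // ltW.
  rewrite expRM_natl; apply: lerXn2r; rewrite ?nnegrE ?expR_ge0 //.
  by apply: le_trans (expR_ge1Dx _); rewrite lerDr.
rewrite expRN ler_pdivrMr ?expR_gt0 //.
apply: le_trans (ler_wpM2l (ltW eta0) ex).
rewrite expr_div_n mulrA ler_pdivlMr ?exprn_gt0 //.
rewrite [l%:R ^+ k.+1]exprS mulrA [leLHS]mulrAC.
by rewrite ler_wpM2r ?exprn_ge0 ?ler0n // [leRHS]mulrC.
Qed.

(** The number of blocks must be large in terms of theta and K, since conflicts
    inside a block cost K / nb, and then l large in terms of the number of
    blocks.  A single small parameter, proportional to 1 - theta, serves as
    lam, 1 - beta and mu. *)
Lemma blocked_transversal (R : realType) (theta K : R) (Q : nat) :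
  0 <= theta -> theta < 1 -> 0 < K -> (0 < Q)%N ->
  exists2 nb : nat, (0 < nb)%N & exists l0 : nat, forall l : nat, (l0 <= l)%N ->
  forall (I T : finType) (e : rel T) (p : T -> I) (cls : T -> 'I_Q) (X : {set T})
    (r : I -> 'I_nb) (chi : I -> 'I_Q -> R),
  symmetric e -> (forall v w, e v w -> p v != p w) ->
  (forall i c, #|cell p cls X i c| = l) ->
  {in X, forall u i, (#|[set w in nbrs e X u | p w == i]| <= 1)%N} ->
  {in X, forall u s, #|[set w in nbrs e X u | r (p w) == s]|%:R
     <= chi (p u) (cls u) * (Q%:R * l%:R) / nb%:R} ->
  (forall i c, 0 <= chi i c <= K) ->
  (forall i, \sum_c chi i c <= Q%:R * theta) ->
  exists Y : {set T}, [/\ Y \subset X, {in Y &, forall u w, ~~ e u w} &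
    forall i, #|[set u in Y | p u == i]| = 1%N].
Proof.
move=> th0 th1 K0 Q0; pose om := 1 - theta; pose kap := om / 12%:R.
have om0 : 0 < om by rewrite subr_gt0.
have om1 : om <= 1 by rewrite /om; lra.
have k0 : 0 < kap by rewrite divr_gt0 ?ltr0n.
have kE : om = 12%:R * kap by rewrite /kap mulrC divfK // pnatr_eq0.
have k1 : 12%:R * kap <= 1 by rewrite -kE.
have d0 : 0 < 1 - kap by lra.
have d3 : 1 - 3%:R * kap <= (1 - kap) ^+ 3.
  rewrite -subr_ge0 (_ : _ - _ = kap ^+ 2 * (3%:R - kap)); last by ring.
  by rewrite mulr_ge0 ?sqr_ge0 //; lra.
have d3' : 0 < (1 - kap) ^+ 3 by rewrite exprn_gt0.
(* This bound on nb makes the cost of conflicts at most kap / 2, and also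
   ensures b K <= om / 2. *)
have [nb0 nbP] := nat_above (16%:R * K / (kap * om)).
pose nb := maxn 1 nb0; have nb_gt0 : (0 < nb)%N by rewrite leq_max.
have nbR : 0 < nb%:R :> R by rewrite ltr0n.
have nbK : 16%:R * K <= nb%:R * (kap * om).
  have kom : 0 < kap * om by exact: mulr_gt0.
  by rewrite -ler_pdivrMr //; apply: nbP; rewrite leq_max leqnn orbT.
pose delta := kap * (om / 2%:R) / nb%:R.
have dl0 : 0 < delta by rewrite /delta !mulr_gt0 ?invr_gt0 ?ltr0n.
pose b := ((1 - kap) ^+ 3 * nb%:R)^-1.
have b0 : 0 < b by rewrite invr_gt0 mulr_gt0.
have [l1 l1P] := @poly_exp_small R (K * Q%:R * expR kap) (kap * delta) (kap / 2%:R) 1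
   ltac:(by rewrite !mulr_ge0 ?expR_ge0 ?ler0n // ltW) (mulr_gt0 k0 dl0)
   ltac:(by rewrite divr_gt0 ?ltr0n).
exists nb => //; exists (maxn 1 l1) => l; rewrite geq_max => /andP[l_gt0 /l1P small2].
have lR : 0 < l%:R :> R by rewrite ltr0n.
have QR : 0 < Q%:R :> R by rewrite ltr0n.
move=> I T e p cls X r chi e_sym e_part cells loc deg chiK avg.
case: (pickP (mem I)) => [i0 _|noI]; last first.
  exists set0; split; rewrite ?sub0set //; first by move=> u w; rewrite inE.
  move=> i.
  by have := noI i.
have [x0 _] : exists x0, x0 \in cell p cls X i0 (Ordinal Q0).
  by apply/set0Pn; rewrite -card_gt0 cells.
have sm : 2%:R * (K * (Q%:R * l%:R) / nb%:R
       / ((1 - kap) ^+ 2 * (Q%:R * l%:R * (om / 2%:R) * (1 - kap))))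
   + K * (Q%:R * l%:R) * expR (kap - kap * (delta * l%:R)) <= 1 - (1 - kap).
  have s1 : 2%:R * (K * (Q%:R * l%:R) / nb%:R
       / ((1 - kap) ^+ 2 * (Q%:R * l%:R * (om / 2%:R) * (1 - kap)))) <= kap / 2%:R.
    rewrite [leLHS](_ : _ = 4%:R * K / (nb%:R * om * (1 - kap) ^+ 3)); last first.
      by field; rewrite !gt_eqF.
    rewrite ler_pdivrMr ?mulr_gt0 //.
    have h2 : 0 <= nb%:R * (kap * om).
      by apply: mulr_ge0 (ltW nbR) _; apply: mulr_ge0; apply: ltW.
    have h1 : 1 <= 2%:R * (1 - kap) ^+ 3 by lra.
    have := ler_wpM2r h2 h1; move: nbK; lra.
  have s2 : K * (Q%:R * l%:R) * expR (kap - kap * (delta * l%:R)) <= kap / 2%:R.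
    apply: le_trans small2; rewrite expRD expr1 -[kap * delta * _]mulrA.
    by rewrite le_eqVlt; apply/orP; left; apply/eqP; ring.
  lra.
have k_lt1 : kap < 1 by lra.
have om2 : 0 < om / 2%:R by rewrite divr_gt0 ?ltr0n.
have bnb : b * nb%:R = ((1 - kap) ^+ 3)^-1.
  by rewrite /b; field; rewrite !gt_eqF.
have amin_le : om / 2%:R <= 1 - nb%:R * (b * theta).
  rewrite mulrA [nb%:R * b]mulrC bnb lerBrDr -lerBrDl mulrC ler_pdivrMr //.
  apply: (@le_trans _ _ ((1 - om / 2%:R) * (1 - 3%:R * kap))); last first.
    by rewrite ler_wpM2l //; lra.
  rewrite (_ : theta = 1 - om); last by rewrite /om; ring.
  rewrite -subr_ge0 kE (_ : _ - _ = kap * (3%:R + 18%:R * kap)); last by field.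
  by rewrite mulr_ge0 //; lra.
have rate : (expR kap - 1) / (1 - kap) <= kap * b * nb%:R * (1 - kap).
  rewrite -[kap * b * _]mulrA bnb ler_pdivrMr //.
  apply: le_trans (expR_subr1_le k0 k_lt1) _.
  by rewrite le_eqVlt; apply/orP; left; apply/eqP; field; rewrite gt_eqF.
have bK : b * K <= om / 2%:R.
  rewrite /b mulrC ler_pdivrMr ?mulr_gt0 //.
  apply: (@le_trans _ _ (16%:R * K)); first by lra.
  apply: (le_trans nbK); rewrite [leLHS](_ : _ = om / 2%:R * (2%:R * kap * nb%:R)); last by field.
  rewrite ler_wpM2l ?(ltW om2) // ler_wpM2r ?(ltW nbR) //; lra.
have slack : nb%:R * delta <= kap * (om / 2%:R).
  by rewrite /delta mulrCA divff ?mulr1 // gt_eqF.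
have [Y [YX Yind _ Y1 _]] := iteration e_sym e_part cells loc deg
  (fun i c => proj1 (andP (chiK i c))) (fun i c => proj2 (andP (chiK i c))) avg
  nb_gt0 Q0 l_gt0 k0 d0 k0 k_lt1 (ltW b0) th0 om2 amin_le dl0 rate bK slack sm x0 (leqnn nb).
by exists Y; split=> // i; apply: Y1; apply: ltn_ord.
Qed.

(** * Transversals from slots of similar vertices *)

(** Combines the three applications of the local lemma.  Sampling and
    splitting into blocks each multiply degrees by B, which is close to 1, and
    add z n; the average degree stays below (1 - om / 2) n, where om = 1 - theta.
    The constant eta, which bounds the local degree relative to the size of a
    slot, is chosen after l. *)
Lemma sampled_transversal (R : realType) (theta K : R) (Q : nat) :
  0 <= theta -> theta < 1 -> 0 < K -> (0 < Q)%N ->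
  exists2 l : nat, (0 < l)%N & exists2 eta : R, 0 < eta &
  forall (I T : finType) (e : rel T) (kap : T -> I * 'I_Q * 'I_l) (Y : {set T})
    (q L : R) (phi : I -> 'I_Q -> R),
  symmetric e -> (forall v w, e v w -> (kap v).1.1 != (kap w).1.1) ->
  0 < q -> (forall k, q <= #|slot kap Y k|%:R) ->
  {in Y, forall v, #|nbrs e Y v|%:R <= phi (kap v).1.1 (kap v).1.2 * (Q%:R * l%:R) * q} ->
  0 <= L -> L <= eta * q ->
  {in Y, forall v i, #|[set w in nbrs e Y v | (kap w).1.1 == i]|%:R <= L} ->
  (forall i c, 0 <= phi i c <= K) ->
  (forall i, \sum_c phi i c <= Q%:R * theta) ->
  exists X : {set T}, [/\ X \subset Y, {in X &, forall u w, ~~ e u w} &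
    forall i, #|[set u in X | (kap u).1.1 == i]| = 1%N].
Proof.
move=> th0 th1 K0 Q0; pose om := 1 - theta; pose z := om / 24%:R.
have om0 : 0 < om by rewrite subr_gt0.
have om1 : om <= 1 by rewrite /om; lra.
have z0 : 0 < z by rewrite divr_gt0 ?ltr0n.
have zE : om = 24%:R * z by rewrite /z mulrC divfK // pnatr_eq0.
have z1 : 24%:R * z <= 1 by rewrite -zE.
have thE : theta = 1 - 24%:R * z by rewrite -zE /om; ring.
clearbody z.
have d0 : 0 < 1 - z by lra.
have [B BE] : exists B, B = (expR z - 1) / (1 - z) / z by eexists.
have B_ge0 : 0 <= B.
  have e1 : 0 <= expR z - 1 by have := expR_ge1Dx z; lra.
  by rewrite BE; apply: divr_ge0; [apply: divr_ge0|]; rewrite // ltW.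
have z_lt1 : z < 1 by lra.
have B_le : B * (1 - 2%:R * z) <= 1.
  apply: (@le_trans _ _ (B * (1 - z) ^+ 2)).
    apply: (ler_wpM2l B_ge0); rewrite -subr_ge0 [leRHS](_ : _ = z ^+ 2) ?sqr_ge0 //; ring.
  rewrite (_ : B * _ = (expR z - 1) * (1 - z) / z); last first.
    by rewrite BE; field; rewrite !gt_eqF.
  by rewrite ler_pdivrMr // mul1r -ler_pdivlMr // expR_subr1_le.
have B_le2 : B <= 12%:R / 11%:R.
  have z24 : 0 <= 24%:R^-1 - z by lra.
  have := mulr_ge0 B_ge0 z24; move: B_le; lra.
have BB : B ^+ 2 * theta <= 1 - 20%:R * z.
  have z12 : 0 <= 1 - 20%:R * z by lra.
  have d2 : 0 <= 1 - 2%:R * z by lra.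
  apply: (@le_trans _ _ ((B * (1 - 2%:R * z)) ^+ 2 * (1 - 20%:R * z))); last first.
    rewrite -[leRHS]mul1r ler_wpM2r // expr_le1 // mulr_ge0 //.
  rewrite thE exprMn -[leRHS]mulrA; apply: ler_wpM2l; first exact: sqr_ge0.
  rewrite -subr_ge0.
  rewrite [leRHS](_ : _ = z ^+ 2 * (84%:R - 80%:R * z)); last by ring.
  by rewrite mulr_ge0 ?sqr_ge0 //; lra.
have avg_le : B ^+ 2 * theta + B * z + z <= 1 - om / 2%:R.
  have Bz : B * z <= 12%:R / 11%:R * z by rewrite ler_wpM2r // ltW.
  move: BB Bz; rewrite zE; lra.
pose K' := 2%:R * K + 1.
have K'0 : 0 < K' by rewrite /K'; lra.
have th0' : 0 <= 1 - om / 2%:R by lra.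
have th1' : 1 - om / 2%:R < 1 by lra.
have [nb nb0 [l0 blockP]] := blocked_transversal th0' th1' K'0 Q0.
have nbR : 0 < nb%:R :> R by rewrite ltr0n.
have QR : 0 < Q%:R :> R by rewrite ltr0n.
have z3 : 0 < z / 3%:R by rewrite divr_gt0 ?ltr0n.
have c1 : 0 < z * z * Q%:R by rewrite !mulr_gt0.
have [l1 l1P] := @poly_exp_small R 2%:R (z * z * Q%:R) (z / 3%:R) 0 ltac:(by rewrite ler0n) c1 z3.
have C2 : 0 <= 2%:R * expR z * K * Q%:R by rewrite !mulr_ge0 ?expR_ge0 ?(ltW K0).
have [l2 l2P] := @poly_exp_small R _ (z * z * Q%:R) (z / 3%:R) 1 C2 c1 z3.
have C3 : 0 <= K' * Q%:R ^+ 2 * expR z by rewrite !mulr_ge0 ?expR_ge0 ?(ltW K'0).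
have c3 : 0 < z * z * Q%:R / nb%:R by rewrite divr_gt0.
have [l3 l3P] := @poly_exp_small R _ (z * z * Q%:R / nb%:R) z 2 C3 c3 z0.
pose l := (l0 + l1 + l2 + l3).+1.
have ll0 : (l0 <= l)%N by rewrite /l -!addnA ltnW // ltnS leq_addr.
have ll1 : (l1 <= l)%N by rewrite /l ltnW // ltnS -!addnA addnCA leq_addr.
have ll2 : (l2 <= l)%N by rewrite /l ltnW // ltnS -addnA addnC -addnA leq_addr.
have ll3 : (l3 <= l)%N by rewrite /l ltnW // ltnS leq_addl.
have {}l1P := l1P l ll1; have {}l2P := l2P l ll2; have {}l3P := l3P l ll3.
have {blockP} blockP := blockP l ll0.
have l_gt0 : (0 < l)%N by [].
have lR : 0 < l%:R :> R by rewrite ltr0n.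
clearbody l.
set n := Q%:R * l%:R in blockP *.
have n0 : 0 < n by rewrite mulr_gt0.
exists l => //.
pose eta := z * (1 - z) ^+ 3 / (9%:R * K * n).
have eta0 : 0 < eta by rewrite divr_gt0 ?mulr_gt0 ?exprn_gt0 ?ltr0n.
exists eta => // I T e kap Y q L phi e_sym e_part q0 slots degY L0 Lq locY phiK avg.
pose p v := (kap v).1.1; pose cls v := (kap v).1.2.
have phi_ge0 i c : 0 <= phi i c by have /andP[] := phiK i c.
have phi_le i c : phi i c <= K by have /andP[] := phiK i c.
pose psi i c := B * phi i c + z.
pose chi i c := B * psi i c + z.
have e_slot v w : e v w -> kap v != kap w.
  by move=> /e_part; apply: contra => /eqP ->.
have [X [XY X1 degX locX]] : exists X : {set T}, [/\ X \subset Y,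
  (forall k, #|X :&: slot kap Y k| = 1%N),
  {in X, forall v, #|nbrs e X v|%:R < psi (p v) (cls v) * n} &
  {in X, forall v i, (#|[set w in nbrs e X v | p w == i]| <= 1)%N}].
  apply: (@sampling R I _ T e kap p Y q (K * n * q) L z (1 - z) (z * (z * n))
    (fun v => phi (p v) (cls v) * n * q)) => //.
  - move=> v vY; rewrite !ler_wpM2r // ltW //.
  - move=> v vY; rewrite /psi.
    rewrite le_eqVlt; apply/orP; left; apply/eqP; rewrite BE; field.
    by rewrite !gt_eqF.
  - have EE : - (z * (z * n)) = - (z * z * Q%:R * l%:R) by rewrite /n; ring.
    rewrite expRD EE; set E := expR (- _) in l1P l2P *.
    have E0 : 0 <= E := expR_ge0 _.
    have inv2 : (1 - z)^-1 <= 2%:R.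
      by rewrite invf_ple ?posrE ?ltr0n //; lra.
    have s1 : E / (1 - z) <= z / 3%:R.
      apply: le_trans l1P; rewrite expr0 mulr1 mulrC.
      by apply: ler_wpM2r.
    have s2 : expR z * E * (K * n * q / (q * (1 - z))) <= z / 3%:R.
      apply: le_trans l2P.
      rewrite [leLHS](_ : _ = (expR z * K * Q%:R * l%:R * E) / (1 - z)); last first.
        by rewrite /n; field; rewrite !gt_eqF.
      rewrite expr1 [leRHS](_ : _ = expR z * K * Q%:R * l%:R * E * 2%:R); last by ring.
      by apply: ler_wpM2l => //; rewrite !mulr_ge0 ?expR_ge0 ?(ltW K0).
    have s3 : 3%:R * (K * n * q * L / (q ^+ 2 * (1 - z) ^+ 3)) <= z / 3%:R.
      rewrite [leLHS](_ : _ = 3%:R * K * n / ((1 - z) ^+ 3 * q) * L); last first.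
        by field; rewrite !gt_eqF.
      rewrite [leRHS](_ : _ = 3%:R * K * n / ((1 - z) ^+ 3 * q) * (eta * q)); last first.
        by rewrite /eta; field; rewrite !gt_eqF.
      apply: ler_wpM2l => //; rewrite divr_ge0 ?mulr_ge0 ?exprn_ge0 ?(ltW K0) ?(ltW n0) ?(ltW d0) ?(ltW q0) //.
    lra.
have psi_ge0 i c : 0 <= psi i c by rewrite /psi addr_ge0 ?mulr_ge0 // ltW.
have Bphi i c : B * phi i c <= 12%:R / 11%:R * K by apply: ler_pM.
have psi_le i c : psi i c <= 12%:R / 11%:R * K + z by rewrite /psi lerD2r.
have chi_gt0 i c : 0 < chi i c by rewrite /chi ltr_wpDl // mulr_ge0.
have Xslot k u : u \in X -> (u \in slot kap Y k) = (kap u == k).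
  by move=> /(subsetP XY) uY; rewrite inE uY.
have cellX i c : #|cell p cls X i c| = l.
  rewrite -sum1_card (partition_big (fun u => (kap u).2) xpredT) //=.
  rewrite (eq_bigr (fun=> 1%N)) ?sum1_card ?card_ord // => j _.
  rewrite sum1dep_card -(X1 (i, c, j)); apply: eq_card => u; rewrite !inE.
  by case uX : (u \in X) => //=; rewrite (subsetP XY) //= /p /cls.
have [r rP] : exists r : I -> 'I_nb, {in X, forall u s,
    #|[set w in nbrs e X u | r (p w) == s]|%:R < chi (p u) (cls u) * n / nb%:R}.
  apply: (@block_assignment R I T e p X nb (fun v => psi (p v) (cls v) * n) _
     (n * (K' * n)) z (1 - z) (z * (z * n / nb%:R))) => //.
  - by move=> u uX; apply/ltW/degX.
  - move=> i; apply: (@le_trans _ _ (\sum_(w in X | p w == i) K' * n)).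
      apply: ler_sum => w /andP[wX _]; apply: le_trans (ltW (degX _ wX)) _.
      rewrite ler_wpM2r ?(ltW n0) //; apply: le_trans (psi_le _ _) _; rewrite /K'; lra.
    rewrite (partition_big cls xpredT) //=.
    rewrite (eq_bigr (fun=> l%:R * (K' * n))); last first.
      move=> c _; rewrite mulr_natl -[in RHS](cellX i c) -sumr_const; apply: eq_bigl => w.
      by rewrite !inE andbA.
    by rewrite sumr_const card_ord -[_ *+ Q]mulr_natl mulrA.
  - by move=> u uX; rewrite !mulr_gt0 ?invr_gt0.
  - move=> u uX; rewrite /chi.
    rewrite le_eqVlt; apply/orP; left; apply/eqP; rewrite BE; field.
    by rewrite !gt_eqF.
  - rewrite expRD [X in expR (- X)](_ : _ = z * z * Q%:R / nb%:R * l%:R); last first.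
      by rewrite /n; field; rewrite gt_eqF.
    rewrite opprB addrCA subrr addr0; apply: le_trans l3P.
    rewrite le_eqVlt; apply/orP; left; apply/eqP; rewrite /n; ring.
have [||Y' [Y'X Yind Y1]] := blockP I T e p cls X r chi e_sym e_part cellX locX
   (fun u uX s => ltW (rP u uX s)).
- move=> i c; rewrite (ltW (chi_gt0 i c)) /chi /=.
  have le1 : B * psi i c <= 12%:R / 11%:R * (12%:R / 11%:R * K + z).
    by apply: ler_pM => //; apply: psi_le.
  move: le1; rewrite /K'; lra.
- move=> i; rewrite /chi big_split /= -mulr_sumr big_split /= -mulr_sumr.
  have sumc (y : R) : \sum_(c < Q) y = Q%:R * y by rewrite sumr_const card_ord mulr_natl.
  rewrite !sumc.
  have := ler_wpM2l (sqr_ge0 B) (avg i).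
  have := ler_wpM2l (ltW QR) avg_le; rewrite !mulrDr; lra.
exists Y'; split=> //; exact: subset_trans Y'X XY.
Qed.

(** * Cutting a part into slots by increasing degree *)

(** Grouping a set by increasing values of d: Q classes of l slots, all slots of
    size k, with one more class kept in reserve at the top. *)
Section Chunks.
Local Open Scope nat_scope.
Variables (U : finType) (V : {set U}) (d : U -> nat) (Q l k : nat).
Hypotheses (Q_gt0 : 0 < Q) (l_gt0 : 0 < l) (k_gt0 : 0 < k).
Hypothesis V_large : Q.+1 * l * k <= #|V|.

Let s := sort (fun u v => d u <= d v) (enum V).
Let pos v := index v s.

Let size_s : size s = #|V|.
Proof. by rewrite size_sort -cardE. Qed.

Let mem_s v : (v \in s) = (v \in V).
Proof. by rewrite mem_sort mem_enum. Qed.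

Let uniq_s : uniq s.
Proof. by rewrite sort_uniq enum_uniq. Qed.

Let pos_lt v : v \in V -> pos v < #|V|.
Proof. by rewrite -mem_s -size_s index_mem. Qed.

Let d_mono x0 i j : i <= j -> j < #|V| -> d (nth x0 s i) <= d (nth x0 s j).
Proof.
move=> ij jV; apply: (sorted_leq_nth (leT := fun u v => d u <= d v)) => //.
- by move=> u v w; apply: leq_trans.
- by apply: sort_sorted => u v; apply: leq_total.
- by rewrite inE size_s (leq_ltn_trans ij).
- by rewrite inE size_s.
Qed.

Let block_card h b : 0 < h -> b.+1 * h <= #|V| ->
  #|[set v in V | pos v %/ h == b]| = h.
Proof.
move=> h0 bV.
have [x0 _] : exists x0, x0 \in V.
  apply/set0Pn; rewrite -card_gt0; apply: leq_trans bV; by rewrite muln_gt0.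
have lt (j : 'I_h) : b * h + j < #|V|.
  by apply: leq_trans bV; rewrite mulSn addnC ltn_add2r ltn_ord.
have -> : [set v in V | pos v %/ h == b]
    = (fun j : 'I_h => nth x0 s (b * h + j)) @: [set: 'I_h].
  apply/setP => v; rewrite inE; apply/andP/imsetP => [[vV /eqP vb]|[j _ ->]].
    have jh : pos v %% h < h by rewrite ltn_pmod.
    exists (Ordinal jh); first by rewrite inE.
    by rewrite /= -vb -divn_eq nth_index // mem_s.
  rewrite -mem_s mem_nth ?size_s ?lt //; split=> //.
  by rewrite /pos index_uniq ?size_s ?lt // divnMDl // divn_small // addn0.
rewrite card_imset ?cardsT ?card_ord // => i j /eqP.
by rewrite nth_uniq ?size_s ?lt // eqn_add2l => /eqP/val_inj.
Qed.

Lemma sorted_slots : exists W : {set U} * (U -> 'I_Q * 'I_l) * ('I_Q -> nat),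
  [/\ W.1.1 \subset V,
    (forall c, #|[set v in W.1.1 | W.1.2 v == c]| = k),
    {in W.1.1, forall v, d v <= W.2 (W.1.2 v).1} &
    \sum_c W.2 c * (l * k) <= \sum_(v in V) d v].
Proof.
have lk0 : 0 < l * k by rewrite muln_gt0 l_gt0.
have [x0 _] : exists x0, x0 \in V.
  apply/set0Pn; rewrite -card_gt0; apply: leq_trans V_large.
  by rewrite !muln_gt0 l_gt0.
pose b v := pos v %/ k.
pose c0 := Ordinal Q_gt0; pose a0 := Ordinal l_gt0.
pose f v := (insubd c0 (b v %/ l), insubd a0 (b v %% l)).
pose W := [set v in V | b v < Q * l].
(* The first element of the next class bounds class c from above and class
   c + 1 from below, so the bounds F c are paid for by the values in the
   classes 1, ..., Q. *)
pose F (c : 'I_Q) := d (nth x0 s (c.+1 * (l * k))).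
have fP v : v \in W -> val (f v).1 = b v %/ l /\ val (f v).2 = b v %% l.
  by rewrite inE => /andP[_ bQ]; rewrite /f /= !val_insubd ltn_pmod // ltn_divLR // bQ.
have F_lt (c : 'I_Q) : c.+1 * (l * k) < #|V|.
  apply: leq_trans V_large; rewrite -mulnA ltn_pmul2r // ltnS; exact: ltn_ord.
exists (W, f, F) => /=; split.
- by apply/subsetP => v; rewrite inE => /andP[].
- move=> [c a].
  have cal : c * l + a < Q * l.
    apply: leq_trans (_ : c.+1 * l <= _); last by rewrite leq_mul2r (ltn_ord c) orbT.
    by rewrite mulSn addnC ltn_add2r ltn_ord.
  rewrite -[RHS](@block_card k (c * l + a)) //; last first.
    apply: leq_trans V_large; rewrite leq_mul2r; apply/orP; right.
    by apply: leq_trans cal _; rewrite mulSn leq_addl.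
  apply: eq_card => v; rewrite !inE -/(b v).
  case vV : (v \in V) => //=.
  apply/andP/eqP => [[bQ /eqP fv]|bv].
    have vW : v \in W by rewrite inE vV.
    by have [] := fP v vW; rewrite fv /= => -> ->; rewrite -divn_eq.
  have bQ : b v < Q * l by rewrite bv.
  have vW : v \in W by rewrite inE vV.
  split=> //; have [f1 f2] := fP v vW; apply/eqP.
  rewrite [f v]surjective_pairing; congr (_, _); apply: val_inj.
    by rewrite f1 bv divnMDl // divn_small // addn0.
  by rewrite f2 bv modnMDl modn_small.
- move=> v vW; have [f1 _] := fP v vW.
  have vV : v \in V by move: vW; rewrite inE => /andP[].
  have -> : d v = d (nth x0 s (pos v)) by rewrite nth_index ?mem_s.
  apply: d_mono => //; rewrite f1 mulnA ltnW // -ltn_divLR // -/(b v).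
  by rewrite -ltn_divLR.
- apply: (@leq_trans (\sum_(c < Q) \sum_(v in V | pos v %/ (l * k) == c.+1) d v)).
    apply: leq_sum => c _.
    have cV : c.+2 * (l * k) <= #|V|.
      apply: leq_trans V_large; rewrite -mulnA leq_mul2r; apply/orP; right.
      by rewrite ltnS; exact: ltn_ord.
    have -> : F c * (l * k) = \sum_(v in V | pos v %/ (l * k) == c.+1) F c.
      rewrite -[in LHS](block_card lk0 cV) mulnC -sum_nat_const.
      by apply: eq_bigl => v; rewrite inE.
    apply: leq_sum => v /andP[vV /eqP bv].
    have -> : d v = d (nth x0 s (pos v)) by rewrite nth_index ?mem_s.
    by apply: d_mono; rewrite ?pos_lt // -bv leq_trunc_div.
  rewrite (exchange_big_dep (mem V)) /=; last by move=> c v _ /andP[].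
  apply: leq_sum => v vV; rewrite sum_nat_const -[leqRHS]mul1n leq_mul2r; apply/orP; right.
  apply/card_le1_eqP => c c' /andP[_ /eqP h] /andP[_ /eqP h'].
  by apply: val_inj; move: h'; rewrite h => -[].
Qed.
End Chunks.

(** * The average degree theorem *)

Section Parts.
Variables (T : finType) (e : rel T) (m : nat) (V : 'I_m -> {set T}).

Lemma nbrs_in_part_le (i j : 'I_m) (u : T) : u \in V i -> i != j ->
  (#|nbrs e (V j) u| <= local_degree e V)%N.
Proof.
move=> uV ij.
apply: (@leq_trans (max_degree (V i :|: V j) (bip_edges e (V i) (V j)))).
  apply: (@leq_trans (degree (bip_edges e (V i) (V j)) u)).
    apply: subset_leq_card; apply/subsetP => w; rewrite !inE => /andP[wV euw].
    by rewrite /bip_edges /= euw uV wV.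
  by rewrite /max_degree (leq_bigmax_cond (F := fun x => degree _ x)) // inE uV.
rewrite /local_degree.
apply: leq_trans (leq_bigmax (F := fun i => \max_(j < m | j != i) _) i).
by apply: (leq_bigmax_cond (P := fun j => j != i)
   (F := fun j => max_degree (V i :|: V j) (bip_edges e (V i) (V j)))); rewrite eq_sym.
Qed.

Hypothesis V_part : vertex_partition V.

Lemma part_of : exists P : T -> 'I_m, forall v i, (v \in V i) = (P v == i).
Proof.
have [Vinj /and3P[/eqP cov /trivIsetP triv _]] := V_part.
have ex v : exists i, v \in V i.
  have : v \in cover [set V i | i : 'I_m] by rewrite cov inE.
  by case/bigcupP => _ /imsetP[i _ ->]; exists i.
have [P PV] := fin_all_exists ex; exists P => v i.
apply/idP/eqP => [vi|<-]; last exact: PV.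
apply/eqP/negPn/negP => ne.
have /triv : V (P v) \in [set V i | i : 'I_m] by apply: imset_f.
move=> /(_ (V i)); rewrite imset_f // => /(_ isT).
have neV : V (P v) != V i by apply: contra ne => /eqP/Vinj ->.
by move=> /(_ neV) /pred0P /(_ v) /=; rewrite vi PV.
Qed.

End Parts.

Theorem theorem1p2 (R : realType) (eps : R) (heps : 0 < eps) :
  exists2 gamma : R, 0 < gamma &
  forall (D : R) (T : finType) (e : rel T) (m : nat) (V : 'I_m -> {set T}),
    0 < D ->
    symmetric e -> irreflexive e ->
    vertex_partition V ->
    (local_degree e V)%:R <= gamma * D ->
    (forall i : 'I_m, (1 + eps) * D <= #|V i|%:R) ->
    (forall i : 'I_m, avg_degree R e (V i) <= D) ->
    exists S : {set T}, independent_transversal e V S.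
Proof.
have [Q0 Q0P] := nat_above (16%:R / eps).
pose Q := maxn 1 Q0; have Q_gt0 : (0 < Q)%N by rewrite leq_max.
have QR : 0 < Q%:R :> R by rewrite ltr0n.
have eps1 : 0 < 1 + eps by lra.
pose y : R := Q%:R^-1.
have y0 : 0 < y by rewrite invr_gt0.
have y1 : y <= 1 by rewrite invf_le1 // ler1n.
have yeps : 16%:R * y <= eps.
  have : 16%:R / eps <= Q%:R by apply: Q0P; rewrite leq_max leqnn orbT.
  by rewrite ler_pdivrMr // /y ler_pdivrMr // mulrC.
clearbody Q.
pose theta := (1 + y) ^+ 4 / (1 + eps).
have y1' : 0 < 1 + y by lra.
have th0 : 0 <= theta by rewrite divr_ge0 ?exprn_ge0 ?(ltW y1') ?(ltW eps1).
have th1 : theta < 1.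
  rewrite ltr_pdivrMr // mul1r.
  have yy : y ^+ 2 <= y by rewrite expr2 ler_piMl // ltW.
  have : (1 + y) ^+ 2 <= 1 + 3%:R * y by rewrite sqrrD; lra.
  have p0 : 0 <= (1 + y) ^+ 2 := sqr_ge0 _.
  move=> h; apply: (@le_lt_trans _ _ ((1 + 3%:R * y) ^+ 2)).
    by rewrite (_ : 4 = 2 * 2)%N // exprM lerXn2r // nnegrE; lra.
  rewrite sqrrD; lra.
have [l l_gt0 [eta eta0 main]] := sampled_transversal th0 th1 QR Q_gt0.
have lR : 0 < l%:R :> R by rewrite ltr0n.
pose N : R := Q.+1%:R * l%:R.
have N0 : 0 < N by rewrite mulr_gt0 ?ltr0n.
pose g1 := eta * (1 + eps) / (N * (1 + y)); pose g2 := (N * Q%:R)^-1.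
have g10 : 0 < g1 by rewrite divr_gt0 ?mulr_gt0.
have g20 : 0 < g2 by rewrite invr_gt0 mulr_gt0.
(* g1 makes the local degree small compared with the size of a slot; g2 makes
   D large as soon as there is an edge between two parts, for then the local
   degree is at least 1. *)
exists (Num.min g1 g2); first by rewrite lt_min g10.
move=> D T e m V D0 e_sym e_irr Vpart loc Vsize Vavg.
have [P PV] := part_of Vpart.
have Vcard i : (0 < #|V i|)%N.
  rewrite -(ltr0n R); apply: lt_le_trans (Vsize i); exact: mulr_gt0.
have [ld0|ld_gt0] := posnP (local_degree e V).
  have [f fV] := fin_all_exists (fun i => set0Pn _ (etrans (esym (card_gt0 _)) (Vcard i))).
  exists [set f i | i : 'I_m]; split.
    move=> _ _ /imsetP[i _ ->] /imsetP[j _ ->]; have [->|ij] := eqVneq i j.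
      by rewrite e_irr.
    apply/negP => ef; have := nbrs_in_part_le e (fV i) ij; rewrite ld0 leqn0 cards_eq0.
    by move=> /eqP/setP/(_ (f j)); rewrite !inE fV ef.
  move=> i; apply/eqP/cards1P; exists (f i); apply/setP => u; rewrite in_setI in_set1.
  apply/andP/eqP => [[/imsetP[j _ ->]]|->]; last by rewrite imset_f.
  by rewrite PV => /eqP <-; have := fV j; rewrite PV => /eqP ->.
have Dlarge : N * Q%:R <= D.
  have : 1 <= g2 * D.
    apply: le_trans (_ : Num.min g1 g2 * D <= _); last first.
      by rewrite ler_wpM2r ?(ltW D0) // ge_min lexx orbT.
    by apply: le_trans loc; rewrite ler1n.
  by rewrite /g2 mulrC ler_pdivlMr ?mulr_gt0 // mul1r.
pose k i := (#|V i| %/ (Q.+1 * l))%N.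
have Nnat : N = (Q.+1 * l)%:R by rewrite natrM.
have k_ge i : (Q <= k i)%N.
  rewrite leq_divRL ?muln_gt0 ?l_gt0 // -(ler_nat R); apply: le_trans (Vsize i).
  rewrite natrM -Nnat mulrC; apply: le_trans Dlarge _; rewrite ler_peMl ?(ltW D0) //; lra.
have k_gt0 i : (0 < k i)%N by apply: leq_trans (k_ge i).
have card_le i : #|V i|%:R <= N * (k i)%:R * (1 + y).
  apply: (@le_trans _ _ (N * (k i).+1%:R)).
    rewrite Nnat -natrM ler_nat; apply: ltnW.
    by rewrite mulnC -ltn_divLR ?muln_gt0 ?l_gt0.
  rewrite -mulrA ler_wpM2l ?(ltW N0) // mulrDr mulr1 -natr1 lerD2l.
  by rewrite /y ler_pdivlMr // mul1r ler_nat.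
pose q := (1 + eps) * D / (N * (1 + y)).
have q0 : 0 < q by rewrite divr_gt0 ?mulr_gt0.
have q_le i : q <= (k i)%:R.
  rewrite /q ler_pdivrMr ?mulr_gt0 //; apply: le_trans (Vsize i) _.
  by apply: le_trans (card_le i) _; rewrite mulrCA mulrA.
have [S SP] := fin_all_exists (fun i => @sorted_slots T (V i) (degree e) Q l (k i)
  Q_gt0 l_gt0 (k_gt0 i) (ltac:(by rewrite mulnC leq_trunc_div))).
pose Y := [set v | v \in (S (P v)).1.1].
(* The slots of the part i have size k i, while q is a common lower bound for
   these sizes; the degree bounds phi are normalised by q. *)
pose kap v := (P v, ((S (P v)).1.2 v).1, ((S (P v)).1.2 v).2).
pose e' : rel T := [rel u w | e u w && (P u != P w)].
pose phi i c : R := ((S i).2 c)%:R / (q * (Q%:R * l%:R)).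
have Ql0 : 0 < Q%:R * l%:R :> R by rewrite mulr_gt0.
have phi_ge0 i c : 0 <= phi i c by rewrite divr_ge0 ?ler0n // ltW // mulr_gt0.
have phi_avg i : \sum_c phi i c <= Q%:R * theta.
  have [_ _ _ sumF] := SP i.
  have NE : N = Q%:R * (1 + y) * l%:R.
    by rewrite /N mulrDr mulr1 /y divff ?gt_eqF // natr1.
  have kR : 0 < (k i)%:R :> R by rewrite ltr0n.
  have le1 : (\sum_c ((S i).2 c)%:R) * (l%:R * (k i)%:R) <= D * (N * (k i)%:R * (1 + y)).
    apply: (@le_trans _ _ (D * #|V i|%:R)); last by rewrite ler_wpM2l ?(ltW D0).
    apply: (@le_trans _ _ (\sum_(u in V i) (degree e u)%:R)).
      by rewrite -natrM -!natr_sum -natrM ler_nat big_distrl.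
    by have := Vavg i; rewrite /avg_degree ler_pdivrMr // ltr0n.
  have le2 : \sum_c ((S i).2 c)%:R <= D * N * (1 + y) / l%:R.
    rewrite ler_pdivlMr // -(ler_pM2r kR) -[leLHS]mulrA; apply: le_trans le1 _.
    by rewrite le_eqVlt; apply/orP; left; apply/eqP; ring.
  have qQl : 0 < q * (Q%:R * l%:R) by exact: mulr_gt0.
  rewrite /phi -mulr_suml ler_pdivrMr //; apply: le_trans le2 _.
  rewrite le_eqVlt; apply/orP; left; apply/eqP; rewrite /q /theta NE; field.
  by rewrite !gt_eqF.
have [||||||||||X [XY Xind X1]] := main 'I_m T e' kap Y q (Num.min g1 g2 * D) phi.
- by move=> u w; rewrite /e' /= e_sym eq_sym.
- by move=> u w /andP[].
- exact: q0.
- move=> [[i c] a]; have [WV cW _ _] := SP i.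
  apply: le_trans (q_le i) _; rewrite ler_nat -(cW (c, a)) subset_leq_card //.
  apply/subsetP => v; rewrite !inE => /andP[vW /eqP fv].
  have /eqP Pv : P v == i by rewrite -PV; apply: (subsetP WV).
  by rewrite /kap Pv vW fv /= eqxx.
- move=> v; rewrite inE => vW; have [_ _ dF _] := SP (P v).
  rewrite /phi /kap /= [leRHS](_ : _ = ((S (P v)).2 ((S (P v)).1.2 v).1)%:R); last first.
    by field; rewrite !gt_eqF.
  rewrite ler_nat; apply: leq_trans (dF v vW); apply: subset_leq_card.
  by apply/subsetP => w; rewrite !inE => /and3P[_ -> _].
- by rewrite mulr_ge0 ?(ltW D0) // le_min !ltW.
- apply: (@le_trans _ _ (g1 * D)).
    by rewrite ler_wpM2r ?(ltW D0) // ge_min lexx.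
  rewrite le_eqVlt; apply/orP; left; apply/eqP; rewrite /q /g1; field.
  by rewrite !gt_eqF.
- move=> v vY i; apply: le_trans loc; rewrite ler_nat /kap /=.
  have [Pv|Pv] := eqVneq (P v) i.
    rewrite (_ : [set w in _ | _] = set0) ?cards0 //; apply/setP => w; rewrite !inE /e' /=.
    by apply/negP => /andP[/and3P[_ _ ne] /eqP Pw]; rewrite Pv Pw eqxx in ne.
  have vV : v \in V (P v) by rewrite PV.
  apply: leq_trans (nbrs_in_part_le e vV Pv); apply: subset_leq_card; apply/subsetP => w.
  by rewrite !inE /e' /= PV => /andP[/and3P[_ -> _] ->].
- move=> i c; rewrite phi_ge0 /=; apply: (@le_trans _ _ (\sum_c phi i c)).
    by rewrite (bigD1 c) //= lerDl sumr_ge0.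
  by apply: le_trans (phi_avg i) _; rewrite ler_piMr ?(ltW QR) ?(ltW th1).
- exact: phi_avg.
exists X; split.
  move=> u w uX wX; have := Xind u w uX wX; rewrite /e' /= negb_and negbK.
  case/orP => // /eqP Puw; apply/negP => euw.
  have := X1 (P u) => /eqP/cards1P[z zP].
  have uz : u = z by apply/set1P; rewrite -zP inE uX /= eqxx.
  have wz : w = z by apply/set1P; rewrite -zP inE wX /= -Puw eqxx.
  by rewrite uz wz e_irr in euw.
move=> i; rewrite -(X1 i); apply: eq_card => u; rewrite [in RHS]inE in_setI PV.
by [].
Qed.
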